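(* Let $d\ge1$, $\sigma\in\mathbb N$ with $\sigma\ge d+1$, $k,l\in\{1,\dots,d\}$, and let $g=\begin{pmatrix} a&\mathbf b^t\\ \mathbf c& D\end{pmatrix}\in\mathrm{SU}(1,d)$ with $b_1,\dots,b_k\ne0$, $b_{k+1}=\cdots=b_d=0$, $c_1,\dots,c_l\neq0$, $c_{l+1}=\cdots=c_d=0$. Then for all $\mathbf m,\mathbf n\in\mathbb N_0^d$ the matrix coefficient $\pi^\sigma_{\mathbf m,\mathbf n}(g)$ is given by $$\pi^\sigma_{\mathbf m,\mathbf n}(g)=\sqrt{\frac{(\sigma)_{|\mathbf m|}(\sigma)_{|\mathbf n|}}{\mathbf m!\,\mathbf n!}}(-1)^{|\mathbf m|}a^{-\sigma-|\mathbf m|-|\mathbf n|}\Big(\prod_{i=1}^kb_i^{n_i}\Big)\Big(\prod_{j=1}^lc_j^{m_j}\Big)$$ $$\times\sum_{(a_{i,j})\in\mathbb M_{k,l}(\mathbf m,\mathbf n)}\frac{\prod_{j=1}^d(-m_j)_{\sum_{i=1}^da_{i,j}}\prod_{i=1}^d(-n_i)_{\sum_{j=1}^da_{i,j}}}{(\sigma)_{\sum_{i,j=1}^da_{i,j}}}\prod_{i,j=1}^d\frac1{a_{i,j}!}$$ $$\times\prod_{j=1}^l\left(\prod_{i=1}^k\Big(1-\tfrac{aD_{j,i}}{b_ic_j}\Big)^{a_{i,j}}\prod_{i=k+1}^d\Big(-\tfrac{aD_{j,i}}{c_j}\Big)^{a_{i,j}}\right)\prod_{j=l+1}^d\left(\prod_{i=1}^k\Big(-\tfrac{aD_{j,i}}{b_i}\Big)^{a_{i,j}}\prod_{i=k+1}^d(-aD_{j,i})^{a_{i,j}}\right),$$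 where $\mathbb M_{k,l}(\mathbf m,\mathbf n)$ is the set of $d\times d$ matrices $(a_{i,j})$ with entries in $\mathbb N_0$ such that $\sum_{j=1}^da_{i,j}=n_i$ for $i=k+1,\dots,d$ and $\sum_{i=1}^da_{i,j}=m_j$ for $j=l+1,\dots,d$.
   Context: Notation: $\mathbb N_0=\{0,1,2,\dots\}$. For $\mathbf x\in\mathbb C^d$: $|\mathbf x|=x_1+\cdots+x_d$ (plain sum), $\|\mathbf x\|=\sqrt{|x_1|^2+\cdots+|x_d|^2}$. For $\mathbf n\in\mathbb N_0^d$: $\mathbf n!=n_1!\cdots n_d!$, $\mathbf x^{\mathbf n}=x_1^{n_1}\cdots x_d^{n_d}$. $(\beta)_n=\beta(\beta+1)\cdots(\beta+n-1)$. Convention $0^0=1$. Group: $J=\mathrm{diag}(1,-1,\ldots,-1)$ of size $d+1$; $\mathrm{SU}(1,d)=\{g\in \mathrm{SL}(d+1,\mathbb C): g^\dagger Jg=J\}$. Elements are written in block form $g=\begin{pmatrix} a&\mathbf b^t\\ \mathbf c& D\end{pmatrix}$ with $a\in\mathbb C$, $\mathbf b,\mathbf c\in\mathbb C^d$ (column vectors), $D$ a complex $d\times d$ matrix. Representation: let $\alpha=\sigma-d-1\in\mathbb N_0$, $\mathbb B_d=\{\mathbf z\in\mathbb C^d:\|\mathbf z\|<1\}$, and $dv_\alpha=c_\alpha(1-\|\mathbf z\|^2)^\alpha dv$, with $dv$ the volume (Lebesgue) measure and the constant $c_\alpha$ chosen so that $v_\alpha(\mathbb B_d)=1$. The Bergman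 space $\mathcal A_\alpha$ is the Hilbert space of holomorphic functions in $L^2(\mathbb B_d,dv_\alpha)$, with inner product $\langle f,h\rangle=\int_{\mathbb B_d}f\,\overline h\,dv_\alpha$ and orthonormal basis $e_{\mathbf m}(\mathbf z)=\sqrt{(\sigma)_{|\mathbf m|}/\mathbf m!}\;\mathbf z^{\mathbf m}$, $\mathbf m\in\mathbb N_0^d$. The unitary representation $\pi^\sigma$ of $\mathrm{SU}(1,d)$ on $\mathcal A_\alpha$ is $$[\pi^\sigma(g)f](\mathbf z)=(a+\mathbf c^t\mathbf z)^{-\sigma}f\!\left(\frac{\mathbf b+D^t\mathbf z}{a+\mathbf c^t\mathbf z}\right),$$ and $\pi^\sigma_{\mathbf m,\mathbf n}(g)=\langle\pi^\sigma(g)e_{\mathbf n},e_{\mathbf m}\rangle$. *)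

(* Defs.v *)
From HB Require Import structures.
From mathcomp Require Import all_boot all_order all_algebra.
From mathcomp Require Import all_classical all_reals all_analysis.
From mathcomp Require Import complex.

Set Implicit Arguments.
Unset Strict Implicit.
Unset Printing Implicit Defensive.

Import Order.TTheory GRing.Theory Num.Theory.

Local Open Scope classical_set_scope.
Local Open Scope ring_scope.
Local Open Scope complex_scope.

(* MathComp-Analysis does not let type inference see that the product of two
   sigma-finite measures is sigma-finite (the instance for subprobabilities
   shadows it), hence this copy of [mu \x nu]. *)
Section prod_measure.
Context d1 d2 (T1 : measurableType d1) (T2 : measurableType d2) (R : realType).
Variable mu : {sigma_finite_measure set T1 -> \bar R}.
Variable nu : {sigma_finite_measure set T2 -> \bar R}.

Definition prod_measure : set (T1 * T2) -> \bar R := (mu \x nu)%E.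
HB.instance Definition _ := Measure.on prod_measure.

Let prod_measure_sigma_finite : sigma_finite setT prod_measure.
Proof.
have /sigma_finiteP[F [TF ndF Foo]] := sigma_finiteT mu.
have /sigma_finiteP[G [TG ndG Goo]] := sigma_finiteT nu.
exists (fun n => F n `*` G n).
  rewrite -setXTT TF TG predeqE => -[x y]; split.
    move=> [/= [n _ Fnx] [k _ Gky]]; exists (maxn n k) => //; split.
    - by move: x Fnx; exact/subsetPset/ndF/leq_maxl.
    - by move: y Gky; exact/subsetPset/ndG/leq_maxr.
  by move=> [n _ []/= ? ?]; split; exists n.
move=> k; have [? ?] := Foo k; have [? ?] := Goo k.
split; first exact: measurableX.
by rewrite /prod_measure product_measure1E// lte_mul_pinfty// ge0_fin_numE.
Qed.
HB.instance Definition _ := Measure_isSigmaFinite.Build _ _ _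
  prod_measure prod_measure_sigma_finite.

End prod_measure.

Section power_measure.
Context d (T : measurableType d) (R : realType).
Variable mu : {sigma_finite_measure set T -> \bar R}.

Definition tcons n (p : T * n.-tuple T) : n.+1.-tuple T :=
  [the n.+1.-tuple T of p.1 :: p.2].

Lemma measurable_tcons n : measurable_fun setT (@tcons n).
Proof. exact: measurable_cons. Qed.
HB.instance Definition _ n :=
  isMeasurableFun.Build _ _ _ _ (@tcons n) (@measurable_tcons n).

Section step.
Variables (n : nat) (nu : {sigma_finite_measure set (n.-tuple T) -> \bar R}).

Definition cons_measure := pushforward (prod_measure mu nu) (@tcons n).

Let cons_measure0 : cons_measure set0 = 0%E.
Proof. exact: measure0. Qed.

Let cons_measure_ge0 A : (0 <= cons_measure A)%E.
Proof. exact: measure_ge0. Qed.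

Let cons_measure_sigma_additive : semi_sigma_additive cons_measure.
Proof. exact: measure_semi_sigma_additive. Qed.

HB.instance Definition _ := isMeasure.Build _ _ _ cons_measure
  cons_measure0 cons_measure_ge0 cons_measure_sigma_additive.

Let cons_measure_sigma_finite : sigma_finite setT cons_measure.
Proof.
have [F FT mF] := sigma_finiteT (prod_measure mu nu).
pose g (t : n.+1.-tuple T) := (thead t, [tuple of behead t]).
have gK : cancel (@tcons n) g by case=> x t; congr pair; exact/val_inj.
have mg : measurable_fun setT g.
  apply: measurable_fun_pair; first exact: measurable_tnth.
  exact: measurable_behead.
exists (fun i => g @^-1` F i).
  by rewrite -preimage_bigcup -FT preimage_setT.
move=> i; have [mFi Foo] := mF i; split.
  by rewrite -[X in measurable X]setTI; exact: mg.
rewrite /cons_measure /pushforward -comp_preimage.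
by rewrite (_ : g \o @tcons n = id) ?preimage_id//; apply/funext => p /=.
Qed.
HB.instance Definition _ := Measure_isSigmaFinite.Build _ _ _
  cons_measure cons_measure_sigma_finite.

End step.

Fixpoint power_measure n : {sigma_finite_measure set (n.-tuple T) -> \bar R} :=
  match n with
  | 0 => \d_ ([tuple] : 0.-tuple T)
  | n'.+1 => cons_measure (power_measure n')
  end.

End power_measure.

Definition pochhammer (K : pzRingType) (x : K) (n : nat) : K :=
  \prod_(i < n) (x + i%:R).

Section multi_index.
Variable d : nat.
Implicit Types m : {ffun 'I_d -> nat}.

Definition mi_sum m : nat := (\sum_i m i)%N.
Definition mi_fact m : nat := (\prod_i (m i)`!)%N.
Definition mi_pow (K : pzRingType) (x : 'cV[K]_d) m : K :=
  \prod_i x i 0 ^+ m i.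

End multi_index.

Section bergman_space.
Context {R : realType} (d : nat).
Local Notation C := R[i].
Local Notation plane := (measurableTypeR R * measurableTypeR R)%type.

(* Lebesgue measure on C^d, where the pair (x, y) of reals stands for x + iy. *)
Definition volume : {sigma_finite_measure set (d.-tuple plane) -> \bar R} :=
  power_measure (prod_measure (@lebesgue_measure R) (@lebesgue_measure R)) d.

Definition cvec (t : d.-tuple plane) : 'cV[C]_d :=
  \col_j ((tnth t j).1 +i* (tnth t j).2).

Definition cnorm (z : 'cV[C]_d) : R :=
  Num.sqrt (\sum_j Normc.normc (z j 0) ^+ 2).

Definition unit_ball : set (d.-tuple plane) := [set t | cnorm (cvec t) < 1].

Definition ball_integral (f : 'cV[C]_d -> C) : C :=
  (\int[volume]_(t in unit_ball) complex.Re (f (cvec t))) +i*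
  (\int[volume]_(t in unit_ball) complex.Im (f (cvec t))).

(* c_alpha, normalizing dv_alpha = c_alpha (1 - |z|^2)^alpha dv to total
   mass 1 on the unit ball. *)
Definition bergman_const (alpha : nat) : R :=
  (\int[volume]_(t in unit_ball) (1 - cnorm (cvec t) ^+ 2) ^+ alpha)^-1.

(* <f, h> = \int_(B_d) f h^* dv_alpha; linear in the first argument. *)
Definition bergman_dot (alpha : nat) (f h : 'cV[C]_d -> C) : C :=
  ball_integral (fun z => f z * conjc (h z) *
    (bergman_const alpha * (1 - cnorm z ^+ 2) ^+ alpha)%:C).

Definition bergman_basis (sigma : nat) (m : {ffun 'I_d -> nat}) :
    'cV[C]_d -> C := fun z =>
  (Num.sqrt (pochhammer sigma%:R (mi_sum m) / (mi_fact m)%:R))%:C * mi_pow z m.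

End bergman_space.

Section representation.
Context {R : realType} (d : nat).
Local Notation C := R[i].
Implicit Types g : 'M[C]_(1 + d).

Definition Jmx : 'M[C]_(1 + d) := block_mx 1%:M 0 0 (- 1%:M).

Definition SU1 : set 'M[C]_(1 + d) :=
  [set g | \det g = 1 /\ (map_mx conjc g)^T *m Jmx *m g = Jmx].

Definition su_pi (sigma : nat) g (f : 'cV[C]_d -> C) : 'cV[C]_d -> C :=
  let a : C := ulsubmx g 0 0 in
  let b : 'cV[C]_d := (ursubmx g)^T in
  let c : 'cV[C]_d := dlsubmx g in
  let D : 'M[C]_d := drsubmx g in
  fun z => let q := a + (c^T *m z) 0 0 in
    q ^- sigma * f (q^-1 *: (b + D^T *m z)).

(* The space on which su_pi sigma acts has weight alpha = sigma - d - 1. *)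
Definition su_pi_coef (sigma : nat) (m n : {ffun 'I_d -> nat}) g : C :=
  bergman_dot (sigma - d.+1) (su_pi sigma g (bergman_basis sigma n))
    (bergman_basis sigma m).

End representation.

(* The summation indices: only rows i > k and columns j > l are constrained,
   with indices starting from 1 (here: from 0, so i >= k and j >= l). *)
Definition index_mx d (k l : nat) (m n : {ffun 'I_d -> nat}) :
    set 'M[nat]_d :=
  [set A | (forall i : 'I_d, (k <= i)%N -> (\sum_j A i j)%N = n i) /\
           (forall j : 'I_d, (l <= j)%N -> (\sum_i A i j)%N = m j)].

(* Main.v *)
Require Import Defs.
From HB Require Import structures.
From mathcomp Require Import all_boot all_order all_algebra.
From mathcomp Require Import all_classical all_reals all_analysis.
From mathcomp Require Import complex.
From mathcomp Require Import measurable_realfun ring lra zify.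
From mathcomp Require polyrcf.

(** The representation acts by a fractional linear substitution, and a matrix
    coefficient is, up to norms of monomials, a Taylor coefficient of the
    transformed basis function.  Write q = a + c^t z and
    E_ij = b_i c_j - a D_ji.  The identity on which everything rests is

      (b_i + (D^t z)_i) / q = a^-1 (b_i - q^-1 sum_j E_ij z_j),

    so that the multinomial theorem, applied to the n_i-th power for each i,
    writes the transformed basis function as a finite sum, over matrices A of
    exponents, of constants times q^(-sigma-|A|) times the monomial whose
    exponents are the column sums of A ([moebius_expand]).  Vanishing b_i and c_j
    are covered uniformly: when b_i = 0 the factor b_i^(n_i - r_i), r_i being the
    i-th row sum, selects by 0^0 = 1 the matrices with r_i = n_i, and in the same
    way c_j = 0 selects the column sums equal to m_j.  These are the constraints
    that define the index set of the formula, and factoring b_i c_j out of E_ij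
    when these do not vanish gives its factors 1 - a D_ji / (b_i c_j)
    ([summandE]).

    It remains to pair q^-t z^s with z^m ([dot_mono_kernel]).  Since g preserves
    the form J, |a|^2 = 1 + |c|^2, hence c^t z / a is bounded on the ball by a
    constant smaller than 1 and q^-t is a uniform limit of polynomials, which may
    be integrated term by term.  As truncation of the binomial series of
    (1 - y)^-t serves the t-th power of a truncated geometric series: its error
    is elementary to bound, and its low coefficients are (t)_k / k!.

    The pairings of monomials ([bergman_dot_monomial]) are the only integrals to
    compute.  Those of distinct monomials vanish because Lebesgue measure on a
    coordinate plane is invariant under the rotation by (3 + 4i)/5, which is not a
    root of unity; this rational rotation is a product of shears, whose invariance
    is Fubini's theorem and invariance under translations.  The norms are Dirichlet
    integrals, computed one coordinate at a time.  By scaling they are all multiples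
    of one power of the area of the unit disc, which enters the normalization of
    the measure as well and cancels. *)

Set Implicit Arguments.
Unset Strict Implicit.
Unset Printing Implicit Defensive.

Import Order.TTheory GRing.Theory Num.Theory.

Local Open Scope classical_set_scope.
Local Open Scope ring_scope.
Local Open Scope complex_scope.

(** * Linear maps and Lebesgue measure on the plane *)

(** Packages the pushforward as a measure together with its change of variables,
    so that uniqueness theorems for measures apply to it. *)
Lemma image_measure d1 d2 (T1 : measurableType d1) (T2 : measurableType d2)
    (R : realType) (mu : {measure set T1 -> \bar R}) (f : T1 -> T2) :
  measurable_fun setT f ->
  exists2 nu : {measure set T2 -> \bar R},
    (forall A, nu A = mu (f @^-1` A)) &
    forall F : T2 -> \bar R, measurable_fun [set: T2] F ->
      (forall x, (0 <= F x)%E) -> (\int[nu]_x F x = \int[mu]_x F (f x))%E.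
Proof.
move=> mf; exists (measure_function_pushforward__canonical__measure_function_Measure mu mf) => //.
by move=> F mF F0; rewrite ge0_integral_pushforward//= preimage_setT.
Qed.

Section measure_preserving.
Context dd (T : measurableType dd) (R : realType).
Variable mu : {measure set T -> \bar R}.

Definition measure_preserving (f : T -> T) :=
  measurable_fun setT f /\ forall A, measurable A -> mu (f @^-1` A) = mu A.

Lemma measure_preserving_comp f g : measure_preserving f ->
  measure_preserving g -> measure_preserving (f \o g).
Proof.
move=> [mf pf] [mg pg]; split; first exact: measurableT_comp.
move=> A mA; rewrite comp_preimage pg ?pf//.
by rewrite -[X in measurable X]setTI; exact: mf.
Qed.

Lemma ge0_integral_preserving f (F : T -> \bar R) : measure_preserving f ->
  measurable_fun [set: T] F -> (forall x, (0 <= F x)%E) ->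
  (\int[mu]_x F (f x) = \int[mu]_x F x)%E.
Proof.
move=> [mf pf] mF F0; have [nu nuE nuI] := image_measure mu mf.
rewrite -nuI//; apply: eq_measure_integral => A mA _.
by rewrite nuE pf.
Qed.

End measure_preserving.

Section plane_measure.
Context {R : realType}.
Local Notation line := (measurableTypeR R).
Local Notation plane := (measurableTypeR R * measurableTypeR R)%type.
Local Notation leb := (@lebesgue_measure R).
Local Notation leb2 := (prod_measure leb leb).

Definition affine (r t : R) (x : line) : line := r * x + t.

Lemma measurable_affine (r t : R) : measurable_fun [set: line] (affine r t).
Proof.
by apply: measurable_funD => //; exact: mulrl_measurable.
Qed.

(** Both sides are measures in [A] that agree on half-open intervals. *)
Lemma lebesgue_affine (r t : R) (A : set line) : 0 < r -> measurable A ->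
  (r%:E * leb (affine r t @^-1` A) = leb A)%E.
Proof.
move=> r0 mA; have [nu nuE _] := image_measure leb (measurable_affine r t).
pose nr : {nonneg R} := NngNum (ltW r0).
rewrite -nuE -[LHS]/(mscale nr nu A).
apply/esym/lebesgue_measure_unique => // {mA}_ [[a b] _ <-] /=.
rewrite /mscale nuE /=.
have -> : affine r t @^-1` `]a, b] =
    [set` `](a - t) / r, (b - t) / r]].
  apply/seteqP; split => x /=; rewrite !in_itv /= ltr_pdivrMr// ler_pdivlMr// ltrBlDr lerBrDr mulrC//.
rewrite !lebesgue_measure_itv /= !lte_fin ltr_pM2r ?invr_gt0// ltrD2r.
case: ifP => _; last by rewrite mule0.
rewrite -!EFinD -EFinM; congr (_%:E); field.
by rewrite gt_eqF.
Qed.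

Lemma lebesgue_shift (t : R) (A : set line) : measurable A ->
  leb ((fun x : line => x + t : line) @^-1` A) = leb A.
Proof.
move=> mA; rewrite -(@lebesgue_affine 1 t A)// mul1e.
by congr (leb _); apply/seteqP; split => x /=; rewrite /affine mul1r.
Qed.

Lemma measurable_plane_lin (a b : R) : measurable_fun [set: plane]
  (fun p : plane => a * p.1 + b * p.2 : line).
Proof.
by apply: measurable_funD; apply: measurable_funM.
Qed.

Definition plane_lin (a b c d : R) (p : plane) : plane :=
  (a * p.1 + b * p.2, c * p.1 + d * p.2).

Lemma measurable_plane_linmap a b c d : measurable_fun setT (plane_lin a b c d).
Proof. by apply: measurable_fun_pair; exact: measurable_plane_lin. Qed.

Lemma plane_swap_preserving : measure_preserving leb2 (plane_lin 0 1 1 0).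
Proof.
split; first exact: measurable_plane_linmap.
move=> A mA.
have [nu nuE _] := image_measure leb2 (measurable_plane_linmap 0 1 1 0).
rewrite -nuE /prod_measure.
apply/esym/product_measure_unique => // {mA}A B mA mB.
rewrite nuE /= /prod_measure.
have -> : plane_lin 0 1 1 0 @^-1` (A `*` B) = B `*` A.
  by apply/seteqP; split => -[x y] [] /=; rewrite !mul0r !mul1r ?addr0 ?add0r.
by rewrite product_measure1E// muleC.
Qed.

(** On each vertical line the shear is a translation. *)
Lemma plane_shear_preserving t : measure_preserving leb2 (plane_lin 1 0 t 1).
Proof.
split; first exact: measurable_plane_linmap.
move=> A mA; rewrite /prod_measure /product_measure1.
apply: eq_integral => x _ /=.
rewrite -(@lebesgue_shift (t * x) (xsection A x)); last by apply: measurable_xsection; exact: mA.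
congr (leb _); apply/seteqP; split => y.
  by rewrite /xsection /= !inE /plane_lin /= mul0r addr0 !mul1r addrC.
by rewrite /xsection /= !inE /plane_lin /= mul0r addr0 !mul1r addrC.
Qed.

(** The angle is chosen with rational cosine and sine, and rational tangent of its
    half, which are the entries of the shears that compose it. *)
Definition rot345 : plane -> plane := plane_lin (3/5) (- (4/5)) (4/5) (3/5).

Lemma rot345_preserving : measure_preserving leb2 rot345.
Proof.
pose W := plane_lin 0 1 1 0; pose S t := plane_lin 1 0 t 1.
(* Shears along the other axis are conjugate to these by the swap [W]; 1/2 is the
   tangent of half the angle. *)
have -> : rot345 = W \o (S (- (1/2)) \o (W \o (S (4/5) \o (W \o (S (- (1/2)) \o W))))).
  apply/funext => -[x y]; rewrite /rot345 /W /S /plane_lin /=.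
  by congr (_, _); field.
by do ![apply: measure_preserving_comp | exact: plane_shear_preserving | exact: plane_swap_preserving].
Qed.

(** Compares the two measures on rectangles, where it is scaling on the line. *)
Lemma ge0_integral_plane_scale (r : R) (F : plane -> \bar R) : 0 < r ->
  measurable_fun setT F -> (forall p, (0 <= F p)%E) ->
  ((r ^+ 2)%:E * \int[leb2]_p F (plane_lin r 0 0 r p) = \int[leb2]_p F p)%E.
Proof.
move=> r0 mF F0.
have [nu nuE nuI] := image_measure leb2 (measurable_plane_linmap r 0 0 r).
have r20 : 0 <= r ^+ 2 by rewrite exprn_ge0// ltW.
pose nr : {nonneg R} := NngNum r20.
transitivity (\int[mscale nr nu]_p F p)%E.
  by rewrite ge0_integral_mscale// nuI.
apply: eq_measure_integral => A mA _; apply/esym.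
apply: product_measure_unique => // {mA}A B mA mB.
rewrite /= /mscale /= nuE /prod_measure.
have -> : plane_lin r 0 0 r @^-1` (A `*` B) =
  (affine r 0 @^-1` A) `*`
  (affine r 0 @^-1` B).
  by apply/seteqP; split => -[x y] [] /=; rewrite /affine !mul0r ?addr0 ?add0r.
have mpre C : measurable C -> measurable (affine r 0 @^-1` C).
  by move=> mC; rewrite -[X in measurable X]setTI; exact: (@measurable_affine r 0).
transitivity ((r ^+ 2)%:E * (leb (affine r 0 @^-1` A) * leb (affine r 0 @^-1` B)))%E.
  by congr (_ * _)%E; apply: product_measure1E; exact: mpre.
rewrite -(lebesgue_affine 0 r0 mA) -(lebesgue_affine 0 r0 mB).
by rewrite expr2 EFinM muleACA.
Qed.

Lemma lebesgue_square (r : R) : 0 <= r ->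
  leb2 ([set` `[- r, r]] `*` [set` `[- r, r]]) = ((2 * r) ^+ 2)%:E.
Proof.
move=> r0.
have lebI : leb ([set` `[- r, r]] : set R) = (2 * r)%:E.
  rewrite lebesgue_measure_itv /= lte_fin opprK -EFinD.
  case: ltP => [_|rr]; first by congr (_%:E); ring.
  have -> : r = 0 by lra.
  by rewrite mulr0.
pose I : set R := [set` `[- r, r]]; transitivity (leb I * leb I)%E.
  by apply: product_measure1E; exact: measurable_itv.
by rewrite /I lebI expr2 EFinM.
Qed.

End plane_measure.

(** * Radial integrals over a disc *)

Section disc_integrals.
Context {R : realType}.
Local Notation line := (measurableTypeR R).
Local Notation plane := (measurableTypeR R * measurableTypeR R)%type.
Local Notation leb := (@lebesgue_measure R).
Local Notation leb2 := (prod_measure leb leb).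

Definition sqmod (p : plane) : R := (p.1 : R) ^+ 2 + (p.2 : R) ^+ 2.

(** The power of the positive part, except that the exponent 0 gives the indicator
    of the positive reals. *)
Definition pos_pow (b : nat) (s : R) : R := if 0 < s then s ^+ b else 0.

Lemma sqmod_ge0 p : 0 <= sqmod p.
Proof. by rewrite addr_ge0// sqr_ge0. Qed.

Lemma pos_pow_ge0 b s : 0 <= pos_pow b s.
Proof. by rewrite /pos_pow; case: ifP => // s0; rewrite exprn_ge0// ltW. Qed.

Lemma pos_powM b r s : 0 < r -> pos_pow b (r * s) = r ^+ b * pos_pow b s.
Proof.
by move=> r0; rewrite /pos_pow pmulr_rgt0// exprMn; case: ifP; rewrite ?mulr0.
Qed.

Lemma pos_powS b s : pos_pow b.+1 s = s * pos_pow b s.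
Proof. by rewrite /pos_pow; case: ifP; rewrite ?mulr0// exprS. Qed.

Lemma measurable_sqmod : measurable_fun [set: plane] sqmod.
Proof.
by apply: measurable_funD; apply: measurable_funX.
Qed.

Lemma measurable_pos_pow b : measurable_fun [set: R] (pos_pow b).
Proof.
apply: measurable_fun_ifT => //.
  exact: measurable_fun_ltr.
Qed.

Lemma measurable_disc_integrand m b s : measurable_fun [set: plane]
  (fun p => sqmod p ^+ m * pos_pow b (s - sqmod p)).
Proof.
apply: measurable_funM; first by apply: measurable_funX; exact: measurable_sqmod.
apply: (measurableT_comp (measurable_pos_pow b)).
by apply: measurable_funB => //; exact: measurable_sqmod.
Qed.

Definition disc_int m b s : \bar R :=
  \int[leb2]_p (sqmod p ^+ m * pos_pow b (s - sqmod p))%:E.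

Lemma disc_integrand_ge0 m b s p :
  (0 <= (sqmod p ^+ m * pos_pow b (s - sqmod p))%:E)%E.
Proof. by rewrite lee_fin mulr_ge0 ?pos_pow_ge0// exprn_ge0// sqmod_ge0. Qed.

Lemma disc_int_ge0 m b s : (0 <= disc_int m b s)%E.
Proof. by apply: integral_ge0 => p _; exact: disc_integrand_ge0. Qed.

Lemma disc_int_out m b s : s <= 0 -> disc_int m b s = 0%E.
Proof.
move=> s0; apply: integral0_eq => p _.
rewrite /pos_pow ltNge subr_le0 (le_trans s0) ?sqmod_ge0//=.
by rewrite mulr0.
Qed.

(** The substitution [p = Num.sqrt s * p']: areas scale by [s] and the integrand is
    homogeneous. *)
Lemma disc_int_scale m b s : 0 < s ->
  disc_int m b s = ((s ^+ (m + b).+1)%:E * disc_int m b 1)%E.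
Proof.
move=> s0; have rs0 : 0 < Num.sqrt s by rewrite sqrtr_gt0.
have mE := measurableT_comp (@EFin_measurable R setT) (@measurable_disc_integrand m b s).
rewrite /disc_int -(@ge0_integral_plane_scale R (Num.sqrt s))//; last first.
  by move=> p; exact: disc_integrand_ge0.
rewrite sqr_sqrtr ?ltW//.
transitivity (s%:E * ((s ^+ (m + b))%:E * disc_int m b 1))%E; last first.
  by rewrite muleA -EFinM exprS.
congr (_ * _)%E; rewrite /disc_int -ge0_integralZl_EFin//=.
- apply: eq_integral => p _; rewrite -EFinM; congr (_%:E).
  have -> : sqmod (plane_lin (Num.sqrt s) 0 0 (Num.sqrt s) p) = s * sqmod p.
    rewrite /sqmod /plane_lin /= !mul0r addr0 add0r !exprMn sqr_sqrtr ?ltW//.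
    by rewrite mulrDr.
  rewrite -{2}(mulr1 s) -mulrBr pos_powM// exprMn exprD; ring.
- by move=> p _; exact: disc_integrand_ge0.
- by apply/measurable_EFinP; exact: measurable_disc_integrand.
- by rewrite exprn_ge0// ltW.
Qed.

(** The disc lies between two squares, so its area is finite and positive. *)
Lemma disc_area_bounds : exists2 C : R, 0 < C & disc_int 0 0 1 = C%:E.
Proof.
pose sq (r : R) : set plane := [set` `[- r, r]] `*` [set` `[- r, r]].
have msq r : measurable (sq r) by apply: measurableX; exact: measurable_itv.
have sqE (r : R) p : sq r p -> p.1 ^+ 2 <= r ^+ 2 /\ p.2 ^+ 2 <= r ^+ 2.
  case; rewrite /= !in_itv /= => /andP[a1 a2] /andP[b1 b2].
  by split; nra.
have up : (disc_int 0 0 1 <= 4%:E)%E.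
  have -> : 4%:E = leb2 (sq 1) by rewrite lebesgue_square//; congr (_%:E); ring.
  rewrite -[sq _]setIT -(@integral_indic _ _ _ leb2 setT)//.
  apply: ge0_le_integral => //=.
  - by move=> p _; exact: disc_integrand_ge0.
  - by apply/measurable_EFinP; exact: measurable_disc_integrand.
  - by apply/measurable_EFinP; exact: measurable_indic.
  move=> [x y] _; rewrite lee_fin expr0 mul1r /pos_pow expr0 subr_gt0.
  case: ifP => // h; rewrite indicE mem_set// /sq /=.
  by move: h; rewrite /sqmod !in_itv /= => h; split; apply/andP; split; nra.
have lo : ((1/4)%:E * 4%:E <= disc_int 0 0 1)%E.
  have -> : ((1/4)%:E * 4%:E)%E = leb2 (sq 2^-1).
    rewrite lebesgue_square; last by lra.
    by rewrite -EFinM; congr (_%:E); field.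
  rewrite -[sq _]setIT -(@integral_indic _ _ _ leb2 setT)//.
  apply: ge0_le_integral => //=.
  - by apply/measurable_EFinP; exact: measurable_indic.
  - by apply/measurable_EFinP; exact: measurable_disc_integrand.
  move=> p _; rewrite lee_fin expr0 mul1r indicE.
  have [/[dup] ps /sqE[h1 h2]|ps] := pselect (sq 2^-1 p); last first.
    by rewrite memNset//= pos_pow_ge0.
  rewrite mem_set//.
  rewrite /pos_pow /sqmod subr_gt0 ifT //; lra.
have fin : disc_int 0 0 1 \is a fin_num.
  by rewrite ge0_fin_numE ?disc_int_ge0// (le_lt_trans up)// ltry.
exists (fine (disc_int 0 0 1)); last by rewrite fineK.
rewrite fine_gt0// (lt_le_trans _ lo)/= ?(le_lt_trans up) ?ltry//.
Qed.

(** The passage to the limit in [disc_int0]. *)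
Lemma poly_ge0_at1 (p : {poly R}) :
  (forall s, 0 < s < 1 -> 0 <= p.[s]) -> 0 <= p.[1].
Proof.
move=> p0; rewrite leNgt; apply/negP => p1.
have [r r0] : exists2 r : R, 0 < r &
    forall y, `|y - 1| < r -> `|p.[y] - p.[1]| < - p.[1].
  have [|e e0 h] := @polyrcf.poly_cont R 1 p (- p.[1]); first by rewrite oppr_gt0.
  by exists e.
move=> /(_ (1 - Num.min (r/2) (1/2))).
have m0 : 0 < Num.min (r/2) (1/2) by rewrite lt_min; apply/andP; split; lra.
have m1 : Num.min (r/2) (1/2) <= 1/2 by rewrite ge_min lexx orbT.
have m2 : Num.min (r/2) (1/2) <= r/2 by rewrite ge_min lexx.
move: (Num.min _ _) m0 m1 m2 => e e0 e1 e2.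
have e3 : `|1 - e - 1| < r by rewrite ltr_norml; apply/andP; split; lra.
have pe : 0 <= p.[1 - e] by apply: p0; apply/andP; split; lra.
move=> /(_ e3); rewrite ltr_norml => /andP[_]; lra.
Qed.

(** In place of polar coordinates, a squeeze: with [g] the moment of the unit disc, homogeneity makes
    the contribution of the annulus between the squared radii [t] and 1 equal to
    [g * (1 - t ^+ m.+1)], while on the annulus the integrand lies between
    [t ^+ m] and 1, so that this lies between [t ^+ m * C * (1 - t)] and
    [C * (1 - t)].  Dividing by [1 - t] and letting [t] tend to 1 gives
    [g * m.+1%:R = C]. *)
Lemma disc_int0 C m s : disc_int 0 0 1 = C%:E ->
  disc_int m 0 s = (C / m.+1%:R * pos_pow m.+1 s)%:E.
Proof.
move=> CE.
pose F k s p : R := sqmod p ^+ k * pos_pow 0 (s - sqmod p).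
have mF k t : measurable_fun setT (EFin \o F k t).
  by apply/measurable_EFinP; exact: measurable_disc_integrand.
have F0 k t p : (0 <= (F k t p)%:E)%E := disc_integrand_ge0 k 0 t p.
have FE k t p : F k t p = if sqmod p < t then sqmod p ^+ k else 0.
  by rewrite /F /pos_pow subr_gt0 expr0; case: ifP; rewrite ?mulr1 ?mulr0.
have le_disc k1 t1 k2 t2 k3 t3 k4 t4 (a b : R) : 0 <= a -> 0 <= b ->
    (forall p, F k1 t1 p + a * F k2 t2 p <= F k3 t3 p + b * F k4 t4 p) ->
    (disc_int k1 0 t1 + a%:E * disc_int k2 0 t2 <=
     disc_int k3 0 t3 + b%:E * disc_int k4 0 t4)%E.
  move=> a0 b0 le.
  have intE k t k' t' (c : R) : 0 <= c ->
    (\int[leb2]_p (F k t p + c * F k' t' p)%:E =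
     disc_int k 0 t + c%:E * disc_int k' 0 t')%E.
    move=> c0; under eq_integral do rewrite EFinD (EFinM c).
    rewrite ge0_integralD//=; last 3 first.
    - exact: mF.
    - by move=> p _; apply: mule_ge0; [rewrite lee_fin | exact: F0].
    - apply/measurable_EFinP; apply: measurable_funM => //.
      exact: measurable_disc_integrand.
    by rewrite ge0_integralZl_EFin//; exact: mF.
  have mL k t k' t' (c : R) : measurable_fun setT (fun p => (F k t p + c * F k' t' p)%:E).
    apply/measurable_EFinP; apply: measurable_funD.
      exact: measurable_disc_integrand.
    by apply: measurable_funM => //; exact: measurable_disc_integrand.
  rewrite -!intE//; apply: ge0_le_integral => //=.
  - by move=> p _; rewrite EFinD (EFinM a) adde_ge0// mule_ge0.
  - by move=> p _; rewrite lee_fin.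
have fin k : disc_int k 0 1 \is a fin_num.
  rewrite ge0_fin_numE ?disc_int_ge0//.
  have := @le_disc k 1 0 1 0 1 0 1 0 0 (lexx _) (lexx _).
  rewrite !mul0e !adde0 CE => /(_ _)/le_lt_trans; apply; last exact: ltry.
  move=> p; rewrite !mul0r !addr0 !FE; case: ifP => // q1.
  by rewrite expr0 exprn_ile1// ?sqmod_ge0// ltW.
have [g gE] : exists g : R, disc_int m 0 1 = g%:E.
  by exists (fine (disc_int m 0 1)); rewrite fineK.
have main : g * m.+1%:R = C.
  have geo (t : R) : 1 - t ^+ m.+1 = (1 - t) * \sum_(i < m.+1) t ^+ i.
    by rewrite -[LHS]opprB subrX1 -mulNr opprB.
  have geo1 : \sum_(i < m.+1) (1 : R) ^+ i = m.+1%:R.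
    under eq_bigr do rewrite expr1n.
    by rewrite sumr_const card_ord.
  (* The polynomials below are the bounds divided by [1 - t], so that they may be
     evaluated at 1. *)
  have lo : 0 <= g * m.+1%:R - C.
    have := @poly_ge0_at1 (g *: (\sum_(i < m.+1) 'X^i) - C *: 'X^m).
    have hE (t : R) : (g *: (\sum_(i < m.+1) 'X^i) - C *: 'X^m).[t] =
        g * (\sum_(i < m.+1) t ^+ i) - C * t ^+ m.
      rewrite !hornerE horner_sum; congr (_ * _ - _).
      by apply: eq_bigr => i _; rewrite hornerXn.
    rewrite hE geo1 expr1n mulr1; apply=> t /andP[t0 t1]; rewrite hE.
    rewrite -(@pmulr_rge0 _ (1 - t)) ?subr_gt0//.
    have := @le_disc m t 0 1 m 1 0 t (t ^+ m) (t ^+ m).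
    rewrite gE CE !(@disc_int_scale _ _ t)// gE CE !addn0 -!EFinM -!EFinD lee_fin.
    move=> /(_ _ _ _)h; rewrite mulrBr (mulrCA (1 - t)) -geo.
    have tm : 0 <= t ^+ m by rewrite exprn_ge0// ltW.
    suff : t ^+ m.+1 * g + t ^+ m * C <= g + t ^+ m * (t ^+ 1 * C).
      by rewrite expr1; lra.
    apply: h => // p; rewrite !FE !expr0.
    have := sqmod_ge0 p; move: (sqmod p) => q q0.
    case: (ltP q t) => qt; first by rewrite (lt_trans qt t1); lra.
    rewrite mulr0 addr0 add0r; case: ifP => // _; last by rewrite mulr0.
    by rewrite mulr1 lerXn2r// nnegrE ltW.
  have up : 0 <= C - g * m.+1%:R.
    have := @poly_ge0_at1 (C%:P - g *: (\sum_(i < m.+1) 'X^i)).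
    have hE (t : R) : (C%:P - g *: (\sum_(i < m.+1) 'X^i)).[t] =
        C - g * (\sum_(i < m.+1) t ^+ i).
      rewrite !hornerE horner_sum; congr (_ - _ * _).
      by apply: eq_bigr => i _; rewrite hornerXn.
    rewrite hE geo1; apply=> t /andP[t0 t1]; rewrite hE.
    rewrite -(@pmulr_rge0 _ (1 - t)) ?subr_gt0//.
    have := @le_disc m 1 0 t m t 0 1 1 1 ler01 ler01.
    rewrite gE CE !(@disc_int_scale _ _ t)// gE CE !addn0 -!EFinM -!EFinD lee_fin.
    move=> /(_ _)h; rewrite mulrBr (mulrCA (1 - t)) -geo.
    suff : g + 1 * (t ^+ 1 * C) <= t ^+ m.+1 * g + 1 * C.
      by rewrite expr1; lra.
    apply: h => // p; rewrite !FE !expr0.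
    have := sqmod_ge0 p; move: (sqmod p) => q q0.
    case: (ltP q t) => qt; first by rewrite (lt_trans qt t1); lra.
    rewrite mulr0 addr0 add0r; case: ifP => q1; last by rewrite mulr0.
    by rewrite mulr1 exprn_ile1// ltW.
  lra.
have [s0|s0] := ltP 0 s; last first.
  by rewrite disc_int_out// /pos_pow ltNge s0 mulr0.
rewrite disc_int_scale// gE addn0 /pos_pow s0 -EFinM -main; congr (_%:E).
by field; rewrite ?nat1r ?natr1 pnatr_eq0.
Qed.

(** Induction on [b] by integrating
    [(s - q) ^+ b.+1 + q * (s - q) ^+ b = s * (s - q) ^+ b], where [q] is the
    squared modulus. *)
Lemma disc_intE C m b s : disc_int 0 0 1 = C%:E ->
  disc_int m b s =
    (C * (m`! * b`!)%:R / ((m + b).+1)`!%:R * pos_pow (m + b).+1 s)%:E.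
Proof.
move=> CE; elim: b m => [|b IH] m.
  rewrite (disc_int0 _ _ CE) fact0 muln1 addn0 factS natrM; congr (_%:E).
  by field; rewrite ?nat1r ?natr1 !pnatr_eq0 -lt0n fact_gt0.
have [s0|s0] := ltP 0 s; last first.
  by rewrite disc_int_out// /pos_pow ltNge s0 mulr0.
have E : (disc_int m b.+1 s + disc_int m.+1 b s = s%:E * disc_int m b s)%E.
  rewrite /disc_int -ge0_integralZl_EFin//; last first.
  - exact: ltW.
  - by apply/measurable_EFinP; exact: measurable_disc_integrand.
  - by move=> p _; exact: disc_integrand_ge0.
  rewrite -ge0_integralD//; last first.
  - by apply/measurable_EFinP; exact: measurable_disc_integrand.
  - by move=> p _; exact: disc_integrand_ge0.
  - by apply/measurable_EFinP; exact: measurable_disc_integrand.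
  - by move=> p _; exact: disc_integrand_ge0.
  apply: eq_integral => p _; rewrite -EFinD -EFinM; congr (_%:E).
  by rewrite pos_powS exprS; ring.
move: E; rewrite !IH => E.
have fin : disc_int m b.+1 s \is a fin_num.
  move: (disc_int_ge0 m b.+1 s) E; case: (disc_int m b.+1 s) => //.
move: E; rewrite -(fineK fin) -EFinM -EFinD => -[] E; congr (_%:E).
move: E => /(canRL (addrK _)) ->.
rewrite /pos_pow s0 addnS addSn !factS !natrM exprS.
rewrite !exprS.
have f0 : (m + b)`!%:R != 0 :> R by rewrite pnatr_eq0 -lt0n fact_gt0.
have k1 : (m + b).+1%:R = m%:R + b%:R + 1 :> R by rewrite -natr1 natrD.
have k2 : (m + b).+2%:R = m%:R + b%:R + 1 + 1 :> R by rewrite -natr1 k1.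
have k10 : m%:R + b%:R + 1 != 0 :> R by rewrite -k1 pnatr_eq0.
have k20 : m%:R + b%:R + 1 + 1 != 0 :> R by rewrite -k2 pnatr_eq0.
rewrite k2 k1 -(natr1 m) -(natr1 b).
by field; rewrite f0 k10 k20.
Qed.
End disc_integrals.

(** * Coordinatewise maps and Dirichlet integrals on a power of the plane *)

Section power_measure_integrals.
Context dd (T : measurableType dd) (R : realType).
Variable mu : {sigma_finite_measure set T -> \bar R}.

(** Tonelli's theorem, the first coordinate being integrated last. *)
Lemma ge0_integral_powerS n (F : n.+1.-tuple T -> \bar R) :
  measurable_fun setT F -> (forall t, (0 <= F t)%E) ->
  (\int[power_measure mu n.+1]_t F t =
   \int[mu]_x \int[power_measure mu n]_t F (tcons (x, t)))%E.
Proof.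
move=> mF F0.
have [nu nuE nuI] := image_measure (prod_measure mu (power_measure mu n)) (@measurable_tcons _ T n).
transitivity (\int[nu]_t F t)%E.
  by apply: eq_measure_integral => A mA _; rewrite nuE.
rewrite nuI//.
apply: (@fubini_tonelli1 _ _ _ _ _ mu (power_measure mu n) (F \o @tcons _ T n)).
- by apply: measurableT_comp => //; exact: measurable_tcons.
- by move=> x; exact: F0.
Qed.

(** Indexed by [nat] rather than ordinals, so that induction on the dimension only
    shifts the family. *)
Definition coordwise n (f : nat -> T -> T) (t : n.-tuple T) : n.-tuple T :=
  [tuple f i (tnth t i) | i < n].

Lemma coordwise_tcons n f x (t : n.-tuple T) :
  coordwise f (tcons (x, t)) = tcons (f 0%N x, coordwise (f \o S) t).
Proof.
apply: eq_from_tnth => i; rewrite tnth_mktuple.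
case: (unliftP ord0 i) => [j ->|->]; last by rewrite !tnth0.
by rewrite /tcons /= !tnthS tnth_mktuple.
Qed.

(** Induction on the dimension; slices of the preimage are preimages of slices. *)
Lemma coordwise_preserving n f : (forall i, measure_preserving mu (f i)) ->
  measure_preserving (power_measure mu n) (@coordwise n f).
Proof.
elim: n f => [|n IH] f pf.
  have -> : @coordwise 0 f = id by apply/funext => t; rewrite [RHS]tuple0 [LHS]tuple0.
  by split.
have [mf' pf'] := IH (f \o S) (fun i => pf i.+1).
have [mf0 pf0] := pf 0%N.
have mcw : measurable_fun setT (@coordwise n.+1 f).
  apply/measurable_fun_tnthP => i.
  rewrite (_ : _ \o _ = f i \o (fun t => tnth t i)); last first.
    by apply/funext => t /=; rewrite tnth_mktuple.
  by apply: measurableT_comp; [case: (pf i)|exact: measurable_tnth].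
split=> // A mA.
rewrite /= /cons_measure /pushforward /prod_measure /product_measure1 /=.
have mtA : measurable (@tcons _ T n @^-1` A).
  by rewrite -[X in measurable X]setTI; exact: measurable_tcons.
rewrite -[RHS](ge0_integral_preserving (pf 0%N))//; last first.
  exact: measurable_fun_xsection.
apply: eq_integral => x _ /=.
have := pf' (xsection (@tcons _ T n @^-1` A) (f 0%N x)) (measurable_xsection _ mtA).
move=> <-.
congr (power_measure mu n _); apply/seteqP.
by split => t; rewrite /xsection /= !inE /= coordwise_tcons.
Qed.

End power_measure_integrals.

Section ball_moments.
Context {R : realType}.
Local Notation plane := (measurableTypeR R * measurableTypeR R)%type.
Local Notation leb := (@lebesgue_measure R).
Local Notation leb2 := (prod_measure leb leb).

Definition dirichlet_fun n (m : nat -> nat) b s (t : n.-tuple plane) : R :=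
  (\prod_(i < n) sqmod (tnth t i) ^+ m i) *
  pos_pow b (s - \sum_(i < n) sqmod (tnth t i)).

Lemma dirichlet_fun_ge0 n m b s (t : n.-tuple plane) : 0 <= dirichlet_fun m b s t.
Proof.
by rewrite mulr_ge0 ?pos_pow_ge0// prodr_ge0// => i _; rewrite exprn_ge0// sqmod_ge0.
Qed.

Lemma measurable_sum_sqmod n : measurable_fun setT
  (fun t : n.-tuple plane => \sum_(i < n) sqmod (tnth t i)).
Proof.
apply: measurable_sum => i; apply: measurableT_comp; first exact: measurable_sqmod.
exact: measurable_tnth.
Qed.

Lemma measurable_dirichlet_fun n m b s :
  measurable_fun setT (@dirichlet_fun n m b s).
Proof.
apply: measurable_funM.
  apply: measurable_prod => i _; apply: measurable_funX.
  by apply: measurableT_comp; [exact: measurable_sqmod|exact: measurable_tnth].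
apply: (measurableT_comp (measurable_pos_pow b)).
by apply: measurable_funB => //; exact: measurable_sum_sqmod.
Qed.

(** Integrating the last [n] coordinates leaves a function of the first one of the
    shape treated in [disc_intE], with a larger exponent. *)
Lemma dirichlet_integral C n m b s : disc_int 0 0 1 = C%:E ->
  (\int[power_measure leb2 n]_t (dirichlet_fun m b s t)%:E =
   (C ^+ n * ((\prod_(i < n) (m i)`!) * b`!)%:R /
     (\sum_(i < n) m i + b + n)`!%:R *
    pos_pow (\sum_(i < n) m i + b + n) s)%:E)%E.
Proof.
move=> CE; elim: n m b s => [|n IH] m b s.
  rewrite /= integral_dirac//; last first.
    by apply/measurable_EFinP; exact: measurable_dirichlet_fun.
  rewrite diracT mul1e /dirichlet_fun !big_ord0 subr0 expr0 add0n addn0 mul1n !mul1r.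
  by rewrite divff ?mul1r// pnatr_eq0 -lt0n fact_gt0.
rewrite ge0_integral_powerS//; last first.
- by move=> t; rewrite lee_fin dirichlet_fun_ge0.
- by apply/measurable_EFinP; exact: measurable_dirichlet_fun.
pose k := (\sum_(i < n) m i.+1 + b + n)%N.
pose K := C ^+ n * ((\prod_(i < n) (m i.+1)`!) * b`!)%:R / k`!%:R.
have C0 : 0 <= C by rewrite -lee_fin -CE disc_int_ge0.
transitivity (\int[leb2]_p (K%:E * (sqmod p ^+ m 0%N * pos_pow k (s - sqmod p))%:E))%E.
  apply: eq_integral => p _.
  transitivity (\int[power_measure leb2 n]_t
     ((sqmod p ^+ m 0%N)%:E * (dirichlet_fun (m \o S) b (s - sqmod p) t)%:E))%E.
    apply: eq_integral => t _; rewrite -EFinM; congr (_%:E).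
    rewrite /dirichlet_fun !big_ord_recl !tnth0 opprD addrA mulrA.
    by congr (_ * _ * pos_pow _ (_ - _)); apply: eq_bigr => i _; rewrite !tnthS.
  rewrite ge0_integralZl_EFin//; last first.
  - by rewrite exprn_ge0// sqmod_ge0.
  - by apply/measurable_EFinP; exact: measurable_dirichlet_fun.
  - by move=> t _; rewrite lee_fin dirichlet_fun_ge0.
  by rewrite IH -!EFinM; congr (_%:E); rewrite /K /k /=; ring.
rewrite ge0_integralZl_EFin//; last first.
- by rewrite /K divr_ge0// mulr_ge0// exprn_ge0.
- by apply/measurable_EFinP; exact: measurable_disc_integrand.
- by move=> p _; exact: disc_integrand_ge0.
rewrite -/(disc_int _ _ _) (disc_intE _ _ _ CE) -EFinM; congr (_%:E).
rewrite !big_ord_recl /=.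
have -> : (m 0 + \sum_(i < n) m (bump 0 i) + b + n.+1)%N = (m 0 + k).+1%N.
  by rewrite /k addnS !addnA.
have f0 : k`!%:R != 0 :> R by rewrite pnatr_eq0 -lt0n fact_gt0.
have g0 : (m 0 + k).+1`!%:R != 0 :> R by rewrite pnatr_eq0 -lt0n fact_gt0.
move: ((m 0%N + k).+1`!%:R) g0 => g g0.
rewrite /K exprS !natrM; move: (k`!%:R) f0 => f f0.
by field; rewrite f0 g0.
Qed.

End ball_moments.

(** * Bounded measurable functions on the unit ball *)

Lemma integral_preserving dd (T : measurableType dd) (R : realType)
    (mu : {measure set T -> \bar R}) (f : T -> T) (B : set T) (g : T -> \bar R) :
  measure_preserving mu f -> measurable B -> f @^-1` B = B ->
  measurable_fun B g -> (\int[mu]_(x in B) g (f x) = \int[mu]_(x in B) g x)%E.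
Proof.
move=> pf mB fB mg.
have key (h : T -> \bar R) : measurable_fun B h -> (forall x, 0 <= h x)%E ->
    (\int[mu]_(x in B) h (f x) = \int[mu]_(x in B) h x)%E.
  move=> mh h0; rewrite integral_mkcond [RHS]integral_mkcond.
  rewrite -[RHS](ge0_integral_preserving pf).
  - apply: eq_integral => x _; rewrite !patchE.
    suff -> : (f x \in B) = (x \in B) by [].
    by rewrite -[in RHS]fB; apply/idP/idP => /set_mem xB; exact/mem_set.
  - exact/(measurable_restrictT _ mB).
  - by move=> x; rewrite patchE; case: ifP.
rewrite integralE [RHS]integralE; congr (_ - _)%E.
  rewrite -(key g^\+)%E//; last exact: measurable_funepos.
  by apply: eq_integral => x _; rewrite !funeposE.
rewrite -(key g^\-)%E//; last exact: measurable_funeneg.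
by apply: eq_integral => x _; rewrite !funenegE.
Qed.

Section ball.
Context {R : realType} (d : nat).
Local Notation C := R[i].
Local Notation plane := (measurableTypeR R * measurableTypeR R)%type.
Local Notation leb := (@lebesgue_measure R).
Local Notation leb2 := (prod_measure leb leb).
Local Notation Re := complex.Re.
Local Notation Im := complex.Im.
Local Notation normc := Normc.normc.
Implicit Types (f g : 'cV[C]_d -> C) (t : d.-tuple plane).

Lemma normc_sqr (z : C) : normc z ^+ 2 = Re z ^+ 2 + Im z ^+ 2.
Proof. by case: z => x y /=; rewrite sqr_sqrtr// addr_ge0// sqr_ge0. Qed.

Lemma normc_ge0 (z : C) : 0 <= normc z.
Proof. by case: z => x y /=; exact: sqrtr_ge0. Qed.

Lemma norm_Re_le (z : C) : `|Re z| <= normc z.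
Proof.
rewrite -ler_sqr ?nnegrE ?normc_ge0// normc_sqr real_normK ?num_real//.
by rewrite lerDl sqr_ge0.
Qed.

Lemma norm_Im_le (z : C) : `|Im z| <= normc z.
Proof.
rewrite -ler_sqr ?nnegrE ?normc_ge0// normc_sqr real_normK ?num_real//.
by rewrite lerDr sqr_ge0.
Qed.

Lemma ReM (x y : C) : Re (x * y) = Re x * Re y - Im x * Im y.
Proof. by case: x y => [a b] [c e]. Qed.

Lemma ImM (x y : C) : Im (x * y) = Re x * Im y + Im x * Re y.
Proof. by case: x y => [a b] [c e]. Qed.

Lemma ReD (x y : C) : Re (x + y) = Re x + Re y.
Proof. by case: x y => [a b] [c e]. Qed.

Lemma ImD (x y : C) : Im (x + y) = Im x + Im y.
Proof. by case: x y => [a b] [c e]. Qed.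

Lemma ReJ (x : C) : Re (conjc x) = Re x.
Proof. by case: x. Qed.

Lemma ImJ (x : C) : Im (conjc x) = - Im x.
Proof. by case: x. Qed.

Lemma normcJ (x : C) : normc (conjc x) = normc x.
Proof. by case: x => a b /=; rewrite sqrrN. Qed.

Lemma cnorm_cvec t : cnorm (cvec t) ^+ 2 = \sum_j sqmod (tnth t j).
Proof.
rewrite /cnorm sqr_sqrtr; last by apply: sumr_ge0 => j _; rewrite exprn_ge0// normc_ge0.
by apply: eq_bigr => j _; rewrite normc_sqr mxE.
Qed.

Lemma unit_ballE : @unit_ball R d = [set t | \sum_j sqmod (tnth t j) < 1].
Proof.
apply/seteqP; split => t; rewrite /unit_ball /= -cnorm_cvec => h.
  by rewrite expr_lt1// sqrtr_ge0.
by rewrite -(@expr_lt1 _ 2)// sqrtr_ge0.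
Qed.

Lemma measurable_unit_ball : measurable (@unit_ball R d).
Proof.
rewrite unit_ballE -[X in measurable X]setTI.
have := @measurable_fun_ltr _ _ R setT _ _ (@measurable_sum_sqmod R d) (@measurable_cst _ _ _ R setT (1 : R)).
by move=> /(_ measurableT [set true]); apply.
Qed.

Lemma coord_unit_ball t j : unit_ball t -> normc (cvec t j 0) <= 1.
Proof.
rewrite unit_ballE /= => h.
rewrite -(@expr_le1 _ 2)// ?normc_ge0// normc_sqr mxE /= -/(sqmod (tnth t j)).
apply: le_trans (ltW h); rewrite (bigD1 j)//= lerDl sumr_ge0// => i _.
exact: sqmod_ge0.
Qed.

(** A class stable under the operations that build all the integrands below, and in
    which integrability is automatic since the ball has finite volume. *)
Definition ball_bmeas f := [/\
  measurable_fun (@unit_ball R d) (fun t => Re (f (cvec t))),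
  measurable_fun (@unit_ball R d) (fun t => Im (f (cvec t))) &
  exists K, forall t, unit_ball t -> normc (f (cvec t)) <= K].

Lemma ball_bmeas_cst (c : C) : ball_bmeas (fun=> c).
Proof. by split; [exact: measurable_cst|exact: measurable_cst|exists (normc c)]. Qed.

Lemma ball_bmeas_coord j : ball_bmeas (fun z => z j 0).
Proof.
have mt : measurable_fun (@unit_ball R d) (fun t => tnth t j).
  by apply: measurable_funTS; exact: measurable_tnth.
split; last by exists 1 => t; exact: coord_unit_ball.
- rewrite (_ : (fun t => _) = (fun t => (tnth t j).1)); last first.
    by apply/funext => t; rewrite mxE.
  by apply: measurableT_comp => //; exact: mt.
- rewrite (_ : (fun t => _) = (fun t => (tnth t j).2)); last first.
    by apply/funext => t; rewrite mxE.
  by apply: measurableT_comp => //; exact: mt.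
Qed.

Lemma ball_bmeasD f g : ball_bmeas f -> ball_bmeas g -> ball_bmeas (fun z => f z + g z).
Proof.
move=> [rf jf [K fK]] [rg jg [L gL]]; split.
- by under eq_fun do rewrite ReD; apply: measurable_funD.
- by under eq_fun do rewrite ImD; apply: measurable_funD.
- exists (K + L) => t tB; rewrite (le_trans (le_normcD _ _))//.
  by rewrite lerD ?fK ?gL.
Qed.

Lemma ball_bmeasM f g : ball_bmeas f -> ball_bmeas g -> ball_bmeas (fun z => f z * g z).
Proof.
move=> [rf jf [K fK]] [rg jg [L gL]]; split.
- under eq_fun do rewrite ReM.
  by apply: measurable_funB; exact: measurable_funM.
- under eq_fun do rewrite ImM.
  by apply: measurable_funD; exact: measurable_funM.
- exists (K * L) => t tB; rewrite Normc.normcM.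
  by rewrite ler_pM ?normc_ge0 ?fK ?gL.
Qed.

Lemma ball_bmeas_conj f : ball_bmeas f -> ball_bmeas (fun z => conjc (f z)).
Proof.
move=> [rf jf [K fK]]; split.
- by under eq_fun do rewrite ReJ.
- by under eq_fun do rewrite ImJ; apply: measurable_funN.
- by exists K => t tB; rewrite normcJ fK.
Qed.

Lemma ball_bmeasX f n : ball_bmeas f -> ball_bmeas (fun z => f z ^+ n).
Proof.
move=> nf; elim: n => [|n IH]; first exact: ball_bmeas_cst.
by under eq_fun do rewrite exprS; exact: ball_bmeasM.
Qed.

Lemma ball_bmeas_sum (I : Type) (s : seq I) (P : pred I) (F : I -> 'cV[C]_d -> C) :
  (forall i, ball_bmeas (F i)) -> ball_bmeas (fun z => \sum_(i <- s | P i) F i z).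
Proof.
move=> nF; elim: s => [|i s IH].
  by under eq_fun do rewrite big_nil; exact: ball_bmeas_cst.
under eq_fun do rewrite big_cons; case: (P i) => //.
exact: ball_bmeasD.
Qed.

Lemma ball_bmeas_prod (I : Type) (s : seq I) (P : pred I) (F : I -> 'cV[C]_d -> C) :
  (forall i, ball_bmeas (F i)) -> ball_bmeas (fun z => \prod_(i <- s | P i) F i z).
Proof.
move=> nF; elim: s => [|i s IH].
  by under eq_fun do rewrite big_nil; exact: ball_bmeas_cst.
under eq_fun do rewrite big_cons; case: (P i) => //.
exact: ball_bmeasM.
Qed.

(** Real inversion is measurable as the power with exponent -1. *)
Lemma ball_bmeasV f (e : R) : 0 < e ->
  (forall t, unit_ball t -> e <= normc (f (cvec t))) ->
  ball_bmeas f -> ball_bmeas (fun z => (f z)^-1).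
Proof.
move=> e0 fe [rf jf [K fK]].
have mN : measurable_fun (@unit_ball R d)
    (fun t => (Re (f (cvec t)) ^+ 2 + Im (f (cvec t)) ^+ 2) `^ (-1)).
  apply: (measurableT_comp (measurable_powR (-1))).
  by apply: measurable_funD; apply: measurable_funX.
have VE (z : C) : z^-1 = (Re z * (Re z ^+ 2 + Im z ^+ 2) `^ (-1)) +i*
    (- Im z * (Re z ^+ 2 + Im z ^+ 2) `^ (-1)).
  by case: z => x y; rewrite powR_inv1 ?addr_ge0 ?sqr_ge0//= mulNr.
split.
- by under eq_fun do rewrite VE /=; apply: measurable_funM.
- under eq_fun do rewrite VE /=; apply: measurable_funM => //.
  exact: measurable_funN.
- exists e^-1 => t tB; rewrite Normc.normcV lef_pV2 ?posrE ?fe//.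
  by rewrite (lt_le_trans e0)// fe.
Qed.
End ball.

(** * The integral over the unit ball *)

Section ball_integral_theory.
Context {R : realType} (d : nat).
Local Notation C := R[i].
Local Notation plane := (measurableTypeR R * measurableTypeR R)%type.
Local Notation leb := (@lebesgue_measure R).
Local Notation leb2 := (prod_measure leb leb).
Local Notation Re := complex.Re.
Local Notation Im := complex.Im.
Local Notation normc := Normc.normc.
Implicit Types (f g : 'cV[C]_d -> C) (t : d.-tuple plane).
Local Notation B := (@unit_ball R d).
Local Notation vol := (@volume R d).

Definition dirichlet_const (m : 'I_d -> nat) (b : nat) : R :=
  ((\prod_(i < d) (m i)`!) * b`!)%:R / (\sum_(i < d) m i + b + d)`!%:R.

(** The total mass of the unit disc enters every moment as the same power, and
    so cancels against the normalizing constant of the weighted measure. *)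
Lemma ball_dirichlet : exists2 A : R, 0 < A & forall m b,
  (\int[vol]_(t in B) (\prod_(i < d) sqmod (tnth t i) ^+ m i *
      (1 - \sum_(i < d) sqmod (tnth t i)) ^+ b)%:E =
   (A * dirichlet_const m b)%:E)%E.
Proof.
have [c c0 cE] := @disc_area_bounds R.
exists (c ^+ d); first exact: exprn_gt0.
(* [dirichlet_integral] takes exponents indexed by [nat]. *)
move=> m b; pose m' k := oapp m 0%N (insub k).
have m'E i : m' (val i) = m i by rewrite /m' valK.
have := dirichlet_integral d m' b 1 cE.
rewrite /pos_pow ltr01 expr1n mulr1 /dirichlet_const.
under eq_bigr do rewrite m'E; under [X in (X + b + d)%N]eq_bigr do rewrite m'E.
rewrite -mulrA => <-.
rewrite integral_mkcond; apply: eq_integral => t _.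
rewrite patchE /dirichlet_fun /pos_pow; under [in RHS]eq_bigr do rewrite m'E.
rewrite subr_gt0 unit_ballE.
case: ifPn => [/set_mem /= ->//|tB]; case: ifP => [tB'|_]; last by rewrite mulr0.
by move/negP: tB; case; exact/mem_set.
Qed.

Lemma volume_ball_lty : (vol B < +oo)%E.
Proof.
have [A A0 AE] := ball_dirichlet.
rewrite -[vol B]mul1e -(integral_cst vol (@measurable_unit_ball R d)).
rewrite (_ : (\int[_]_(_ in _) _)%E = (A * dirichlet_const (fun=> 0%N) 0)%:E) ?ltry//.
by rewrite -AE; apply: eq_integral => t _; rewrite expr0 mulr1 big1.
Qed.

Lemma ball_bmeas_integrable f : ball_bmeas f ->
  vol.-integrable B (EFin \o (fun t => Re (f (cvec t)))) /\
  vol.-integrable B (EFin \o (fun t => Im (f (cvec t)))).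
Proof.
move=> [rf jf [K fK]].
have bd (h : d.-tuple plane -> R) : measurable_fun B h ->
    (forall t, B t -> `|h t| <= K) -> vol.-integrable B (EFin \o h).
  move=> mh hK; apply: measurable_bounded_integrable => //.
  - exact: measurable_unit_ball.
  - exact: volume_ball_lty.
  - exists K; split; first exact: num_real.
    by move=> x Kx t tB; rewrite /= (le_trans (hK t tB))// ltW.
split; apply: bd => // t tB; apply: le_trans (fK t tB).
  exact: norm_Re_le.
exact: norm_Im_le.
Qed.

Lemma ball_integralD f g : ball_bmeas f -> ball_bmeas g ->
  ball_integral (fun z => f z + g z) = ball_integral f + ball_integral g.
Proof.
move=> /ball_bmeas_integrable[rf jf] /ball_bmeas_integrable[rg jg].
rewrite /ball_integral.
have mB := @measurable_unit_ball R d.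
under eq_Rintegral do rewrite ReD.
under [X in _ +i* X]eq_Rintegral do rewrite ImD.
by rewrite !RintegralD.
Qed.

Lemma ball_integralZ (c : C) f : ball_bmeas f ->
  ball_integral (fun z => c * f z) = c * ball_integral f.
Proof.
move=> /ball_bmeas_integrable[rf jf].
have mB := @measurable_unit_ball R d.
have scal h (a : R) : vol.-integrable B (EFin \o h) ->
    vol.-integrable B (EFin \o (fun t => a * h t)).
  by move=> ih; apply: (eq_integrable mB) (integrableZl mB a ih) => t _ /=; rewrite EFinM.
rewrite /ball_integral.
under eq_Rintegral do rewrite ReM.
under [X in _ +i* X]eq_Rintegral do rewrite ImM.
rewrite RintegralB//; [|exact: scal|exact: scal].
rewrite RintegralD//; [|exact: scal|exact: scal].
rewrite !RintegralZl//.
by case: c {scal} => a b /=.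
Qed.

Lemma ball_integral0 : ball_integral (fun _ : 'cV[C]_d => 0) = 0.
Proof.
transitivity (ball_integral (fun z : 'cV[C]_d => 0 * (fun=> 1 : C) z)).
  by congr ball_integral; apply/funext => z; rewrite mul0r.
by rewrite ball_integralZ ?mul0r//; exact: ball_bmeas_cst.
Qed.

Lemma ball_integral_sum (I : Type) (s : seq I) (P : pred I)
    (F : I -> 'cV[C]_d -> C) : (forall i, ball_bmeas (F i)) ->
  ball_integral (fun z => \sum_(i <- s | P i) F i z) =
  \sum_(i <- s | P i) ball_integral (F i).
Proof.
move=> nF; elim: s => [|i s IH].
  rewrite big_nil -[RHS]ball_integral0.
  by congr ball_integral; apply/funext => z; rewrite big_nil.
rewrite big_cons -IH; under eq_fun do rewrite big_cons.
by case: (P i) => //; rewrite ball_integralD//; exact: ball_bmeas_sum.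
Qed.

Lemma eq_ball_integral f g : (forall t, B t -> f (cvec t) = g (cvec t)) ->
  ball_integral f = ball_integral g.
Proof.
by move=> fg; rewrite /ball_integral; congr (_ +i* _); apply: eq_Rintegral => t /set_mem tB; rewrite fg.
Qed.

(** The factor 2 comes from bounding the real and imaginary parts separately. *)
Lemma ball_integral_le f (e : R) : ball_bmeas f ->
  (forall t, B t -> normc (f (cvec t)) <= e) ->
  normc (ball_integral f) <= 2 * (e * fine (vol B)).
Proof.
move=> /ball_bmeas_integrable[rf jf] fe.
have mB := @measurable_unit_ball R d.
have bd (h : d.-tuple plane -> R) : vol.-integrable B (EFin \o h) ->
    (forall t, B t -> `|h t| <= e) -> `|\int[vol]_(t in B) h t| <= e * fine (vol B).
  move=> ih he; apply: (le_trans (le_normr_Rintegral _ _)) => //.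
  rewrite -Rintegral_cst//; apply: le_Rintegral => //.
  - exact: integrable_norm.
  - exact: (ball_bmeas_integrable (ball_bmeas_cst d e%:C)).1.
have rb := bd _ rf (fun t tB => le_trans (norm_Re_le _) (fe t tB)).
have jb := bd _ jf (fun t tB => le_trans (norm_Im_le _) (fe t tB)).
rewrite /ball_integral -[X in normc X]/(_ +i* _).
move: rb jb; set x := Rintegral _ _ _; set y := Rintegral _ _ _ => rb jb.
have -> : x +i* y = x%:C + y *i by apply/eqP; rewrite eq_complex /= addr0 add0r !eqxx.
rewrite (le_trans (le_normcD _ _))//.
rewrite mulr2n /= !expr0n /= addr0 add0r !sqrtr_sqr mulrDl !mul1r lerD//.
Qed.

End ball_integral_theory.

(** * Orthogonality and norms of the monomials *)

Section pochhammer_theory.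
Variable K : pzRingType.

Lemma pochhammer0 (x : K) : pochhammer x 0 = 1.
Proof. by rewrite /pochhammer big_ord0. Qed.

Lemma pochhammerSr (x : K) n : pochhammer x n.+1 = pochhammer x n * (x + n%:R).
Proof. by rewrite /pochhammer big_ord_recr. Qed.

End pochhammer_theory.

Lemma pochhammer_fact (K : comPzRingType) (s n : nat) :
  pochhammer s.+1%:R n * s`!%:R = (s + n)`!%:R :> K.
Proof.
elim: n => [|n IH]; first by rewrite pochhammer0 mul1r addn0.
by rewrite pochhammerSr mulrAC IH addnS factS mulnC natrM -natrD addSn.
Qed.

Section unit_rotation.
Context {R : rcfType}.
Local Notation C := R[i].

Definition unit345 : C := (3 / 5) +i* (4 / 5).

Lemma unit345_conj : unit345 * conjc unit345 = 1.
Proof. by apply/eqP; rewrite eq_complex /=; apply/andP; split; apply/eqP; field. Qed.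

(** Since (3 + 4i)^2 = -7 + 24i is congruent to 3 + 4i modulo 5, so are all the
    powers of 3 + 4i; in particular none of them is real. *)
Lemma pow345 n : exists k l : int,
  (5 * unit345) ^+ n.+1 = (3 + 5 * k%:~R) +i* (4 + 5 * l%:~R).
Proof.
elim: n => [|n [k [l IH]]].
  exists 0, 0; rewrite expr1; apply/eqP; rewrite eq_complex /=.
  by apply/andP; split; apply/eqP; field.
exists (3 * k - 4 * l - 2)%R, (4 * k + 3 * l + 4)%R; rewrite exprS IH.
apply/eqP; rewrite eq_complex /= !intrD ?rmorphN ?rmorphB ?rmorphD ?rmorphM /=.
by apply/andP; split; apply/eqP; field.
Qed.

Lemma unit345_expr_neq1 n : (0 < n)%N -> unit345 ^+ n != 1.
Proof.
case: n => // n _; apply/eqP => un.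
have [k [l]] := pow345 n; rewrite exprMn un mulr1.
rewrite -natrX -[X in X = _](rmorph_nat (real_complex R)) => /(congr1 (@complex.Im R)) /=.
have -> : 4 + 5 * l%:~R = (4 + 5 * l)%:~R :> R by rewrite rmorphD rmorphM.
move=> /esym/eqP; rewrite intr_eq0; lia.
Qed.

Lemma unit345_expr_inj a b : unit345 ^+ a * conjc unit345 ^+ b = 1 -> a = b.
Proof.
have conjX (x : C) n : conjc (x ^+ n) = conjc x ^+ n by exact: rmorphXn.
have conjM (x y : C) : conjc (x * y) = conjc x * conjc y by exact: rmorphM.
wlog ab : a b / (b <= a)%N.
  move=> H; case: (leqP b a) => [|/ltnW] ab e; first exact: H.
  apply/esym/H => //; move: e => /(congr1 conjc).
  by rewrite conjc1 conjM !conjX conjcK mulrC.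
rewrite -(subnK ab) exprD -mulrA -exprMn unit345_conj expr1n mulr1.
case: (posnP (a - b)) => [->//|/unit345_expr_neq1/eqP h /h //].
Qed.

End unit_rotation.

Section moments.
Context {R : realType} (d : nat).
Local Notation C := R[i].
Local Notation plane := (measurableTypeR R * measurableTypeR R)%type.
Local Notation leb := (@lebesgue_measure R).
Local Notation leb2 := (prod_measure leb leb).
Local Notation Re := complex.Re.
Local Notation Im := complex.Im.
Local Notation normc := Normc.normc.
Implicit Types (f g : 'cV[C]_d -> C) (t : d.-tuple plane) (p m : {ffun 'I_d -> nat}).
Local Notation B := (@unit_ball R d).
Local Notation vol := (@volume R d).

Definition rotate_coord (j : 'I_d) (z : 'cV[C]_d) : 'cV[C]_d :=
  \col_i ((if i == j then unit345 else 1) * z i 0).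

Lemma mi_pow_rotate j z p :
  mi_pow (rotate_coord j z) p = unit345 ^+ p j * mi_pow z p.
Proof.
rewrite /mi_pow (bigD1 j)//= [in RHS](bigD1 j)//= mxE eqxx exprMn -mulrA.
congr (_ * (_ * _)); apply: eq_bigr => i ij.
by rewrite mxE (negbTE ij) mul1r.
Qed.

(** The rotation of one coordinate preserves both the volume and the ball. *)
Lemma ball_integral_rotate j f : ball_bmeas f ->
  ball_integral (fun z => f (rotate_coord j z)) = ball_integral f.
Proof.
move=> nf.
pose F (i : nat) : plane -> plane := if i == j then rot345 else id.
pose cw := @coordwise _ plane d F.
have pcw : measure_preserving vol cw.
  apply: coordwise_preserving => i; rewrite /F; case: ifP => _.
    exact: rot345_preserving.
  by split.
have sq345 q : sqmod (rot345 q) = sqmod q :> R.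
  by rewrite /sqmod /rot345 /plane_lin /=; field.
have sqcw t i : sqmod (tnth (cw t) i) = sqmod (tnth t i).
  by rewrite tnth_mktuple /F; case: ifP => // _; rewrite sq345.
have cwB : cw @^-1` B = B.
  rewrite unit_ballE; apply/funext => t; rewrite -[LHS]/(_ < 1 : Prop).
  by rewrite (eq_bigr _ (fun i _ => sqcw t i)).
have cvecE t : cvec (cw t) = rotate_coord j (cvec t).
  apply/colP => i; rewrite !mxE tnth_mktuple /F -val_eqE.
  case: ifP => _; last by rewrite mul1r.
  apply/eqP; rewrite eq_complex /= mulNr.
  by apply/andP; split; apply/eqP; ring.
have mB := @measurable_unit_ball R d.
have [rf jf _] := nf.
rewrite /ball_integral; congr (_ +i* _); rewrite /Rintegral; congr fine.
  rewrite -[RHS](integral_preserving pcw mB cwB); last exact/measurable_EFinP.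
  by apply: eq_integral => t _; rewrite cvecE.
rewrite -[RHS](integral_preserving pcw mB cwB); last exact/measurable_EFinP.
by apply: eq_integral => t _; rewrite cvecE.
Qed.

Lemma cnorm_sqr (z : 'cV[C]_d) :
  (cnorm z ^+ 2)%:C = \sum_j z j 0 * conjc (z j 0).
Proof.
rewrite /cnorm sqr_sqrtr; last by apply: sumr_ge0 => j _; rewrite exprn_ge0// normc_ge0.
rewrite rmorph_sum /=; apply: eq_bigr => j _.
by rewrite -sqr_normc rmorphXn.
Qed.

Lemma ball_weightE (z : 'cV[C]_d) b :
  ((1 - cnorm z ^+ 2) ^+ b)%:C = (1 - \sum_j z j 0 * conjc (z j 0)) ^+ b.
Proof. by rewrite rmorphXn rmorphB rmorph1 /= cnorm_sqr. Qed.

Lemma ball_bmeas_weight b : ball_bmeas (fun z : 'cV[C]_d => ((1 - cnorm z ^+ 2) ^+ b)%:C).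
Proof.
under eq_fun do rewrite ball_weightE; apply: ball_bmeasX.
apply: ball_bmeasD; first exact: ball_bmeas_cst.
under eq_fun do rewrite -mulN1r; apply: ball_bmeasM; first exact: ball_bmeas_cst.
apply: ball_bmeas_sum => j; apply: ball_bmeasM; first exact: ball_bmeas_coord.
by apply: ball_bmeas_conj; exact: ball_bmeas_coord.
Qed.

Lemma ball_bmeas_mi_pow p : ball_bmeas (fun z : 'cV[C]_d => mi_pow z p).
Proof. by apply: ball_bmeas_prod => j; apply: ball_bmeasX; exact: ball_bmeas_coord. Qed.

(** Rotating a coordinate in which the exponents differ multiplies the integrand by
    a constant other than 1. *)
Lemma ball_moment_offdiag p m b : p != m ->
  ball_integral (fun z : 'cV[C]_d =>
    mi_pow z p * conjc (mi_pow z m) * ((1 - cnorm z ^+ 2) ^+ b)%:C) = 0.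
Proof.
move=> pm; set f := fun z => _.
have nf : ball_bmeas f.
  apply: ball_bmeasM; last exact: ball_bmeas_weight.
  by apply: ball_bmeasM; [|apply: ball_bmeas_conj]; exact: ball_bmeas_mi_pow.
have [j jpm] : exists j, p j != m j.
  apply/existsP; rewrite -negb_forall; apply: contra pm => /forallP pm.
  by apply/eqP/ffunP => j; apply/eqP.
pose w : C := unit345 ^+ p j * conjc unit345 ^+ m j.
have frot z : f (rotate_coord j z) = w * f z.
  rewrite /f !mi_pow_rotate !ball_weightE rmorphM /= rmorphXn /=.
  have -> : \sum_i rotate_coord j z i 0 * conjc (rotate_coord j z i 0) =
      \sum_i z i 0 * conjc (z i 0).
    apply: eq_bigr => i _; rewrite mxE; case: ifP => _; last by rewrite mul1r.
    by rewrite rmorphM mulrACA /= unit345_conj mul1r.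
  by rewrite /w; ring.
have := ball_integral_rotate j nf.
under eq_fun do rewrite frot; rewrite ball_integralZ// => /eqP.
rewrite -subr_eq0 -{2}(mul1r (ball_integral f)) -mulrBl mulf_eq0 subr_eq0.
case/orP => /eqP // w1; case/eqP: jpm.
exact: unit345_expr_inj w1.
Qed.

Lemma ball_moment_diag : exists2 A : R, 0 < A & forall m b,
  ball_integral (fun z : 'cV[C]_d =>
    mi_pow z m * conjc (mi_pow z m) * ((1 - cnorm z ^+ 2) ^+ b)%:C) =
  (A * @dirichlet_const R d m b)%:C.
Proof.
have [A A0 AE] := @ball_dirichlet R d; exists A => // m b.
have fE t : let z := cvec t in
    mi_pow z m * conjc (mi_pow z m) * ((1 - cnorm z ^+ 2) ^+ b)%:C =
    (\prod_(i < d) sqmod (tnth t i) ^+ m i *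
      (1 - \sum_(i < d) sqmod (tnth t i)) ^+ b)%:C.
  rewrite /= rmorphM /= cnorm_cvec; congr (_ * _).
  rewrite /mi_pow rmorph_prod /= -big_split rmorph_prod /=.
  apply: eq_bigr => i _; rewrite !rmorphXn /= -exprMn mxE.
  by congr (_ ^+ _); apply/eqP; rewrite eq_complex /= /sqmod; apply/andP; split; apply/eqP; ring.
rewrite /ball_integral.
under eq_Rintegral do rewrite fE /=.
under [X in _ +i* X]eq_Rintegral do rewrite fE /=.
congr (_ +i* _); last by rewrite /Rintegral integral0.
by rewrite /Rintegral AE.
Qed.

Lemma dirichlet_const_neq0 (m : 'I_d -> nat) b : @dirichlet_const R d m b != 0.
Proof.
rewrite mulf_neq0 ?invr_eq0// pnatr_eq0 -lt0n ?fact_gt0//.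
by rewrite muln_gt0 fact_gt0 andbT prodn_gt0// => i; rewrite fact_gt0.
Qed.

Lemma dirichlet_constE m b :
  @dirichlet_const R d m b / @dirichlet_const R d (fun _ : 'I_d => 0%N) b =
  (mi_fact m)%:R / pochhammer (b + d).+1%:R (mi_sum m).
Proof.
have f0 n : n`!%:R != 0 :> R by rewrite pnatr_eq0 -lt0n fact_gt0.
have := pochhammer_fact R (b + d) (mi_sum m).
have -> : (b + d + mi_sum m = mi_sum m + b + d)%N by rewrite addnC addnA.
rewrite /dirichlet_const -/(mi_fact m) -/(mi_sum m) => E.
rewrite !natrM (eq_bigr (fun=> 1%N))// big1_eq big1_eq add0n -E.
have p0 : pochhammer (b + d).+1%:R (mi_sum m) != 0 :> R.
  by apply/eqP => p0; move: E; rewrite p0 mul0r => /esym/eqP; apply/negP.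
by field; rewrite p0 !f0.
Qed.

(** The normalizing constant is the inverse of the integral for the exponent 0, and
    the unknown factor [A] is common to all the diagonal integrals. *)
Lemma bergman_dot_monomial (b : nat) p m :
  bergman_dot b (fun z : 'cV[C]_d => mi_pow z p) (fun z => mi_pow z m) =
  if p == m then ((mi_fact m)%:R / pochhammer (b + d).+1%:R (mi_sum m))%:C else 0.
Proof.
rewrite /bergman_dot.
have [A A0 AE] := ball_moment_diag.
have cE : @bergman_const R d b = (A * @dirichlet_const R d (fun _ : 'I_d => 0%N) b)^-1.
  rewrite /bergman_const; congr (_^-1).
  have := AE [ffun=> 0%N] b.
  move=> /(congr1 (@complex.Re R)) /=.
  have -> : @dirichlet_const R d [ffun=> 0%N] b = @dirichlet_const R d (fun _ : 'I_d => 0%N) b.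
    by congr dirichlet_const; apply/funext => i; rewrite ffunE.
  move=> <-; apply: eq_Rintegral => t _.
  rewrite /mi_pow big1 ?conjc1 ?mul1r//.
  by move=> i _; rewrite ffunE expr0.
transitivity ((@bergman_const R d b)%:C * ball_integral (fun z : 'cV[C]_d =>
    mi_pow z p * conjc (mi_pow z m) * ((1 - cnorm z ^+ 2) ^+ b)%:C)).
  rewrite -ball_integralZ; last first.
    apply: ball_bmeasM; last exact: ball_bmeas_weight.
    by apply: ball_bmeasM; [|apply: ball_bmeas_conj]; exact: ball_bmeas_mi_pow.
  by congr ball_integral; apply/funext => z; rewrite rmorphM /=; ring.
case: eqP => [->|/eqP pm]; last by rewrite ball_moment_offdiag// mulr0.
rewrite AE cE -rmorphM /= -dirichlet_constE; congr (_%:C).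
by field; rewrite dirichlet_const_neq0 gt_eqF.
Qed.

End moments.

(** * Multinomial expansions and truncated binomial series *)

Section divided_powers.
Variables (K : numFieldType).

Lemma natr_fact_neq0 n : n`!%:R != 0 :> K.
Proof. by rewrite pnatr_eq0 -lt0n fact_gt0. Qed.

(** Truncated exponential series turn sums into products, which is the multinomial
    theorem read on coefficients. *)
Lemma coef_prod_exp (I : finType) (x : I -> K) (N k : nat) : (k <= N)%N ->
  (\prod_(i : I) \poly_(l < N.+1) (x i ^+ l / l`!%:R))`_k =
  (\sum_i x i) ^+ k / k`!%:R.
Proof.
move: k; pose P (p : {poly K}) (y : K) :=
  forall k, (k <= N)%N -> p`_k = y ^+ k / k`!%:R.
apply: (big_ind2 P).
- by case=> [|k] _; rewrite coef1 ?expr0 ?fact0 ?divr1// exprS !mul0r.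
- move=> p x1 q y1 hp hq k kN; rewrite coefMr exprDn mulr_suml.
  apply: eq_bigr => i _; have ik : (i <= k)%N by rewrite -ltnS.
  rewrite hp ?hq ?(leq_trans _ kN)// ?leq_subr// ?ik//.
  rewrite -(mulr_natr (_ * _)) -(bin_fact ik) !natrM.
  have b0 : 'C(k, i)%:R != 0 :> K by rewrite pnatr_eq0 -lt0n bin_gt0.
  have := natr_fact_neq0 i; have := natr_fact_neq0 (k - i).
  move: (i`!%:R) ((k - i)`!%:R) ('C(k, i)%:R) b0 => u v w w0 v0 u0.
  by field; rewrite u0 v0 w0.
- by move=> i _ k kN; rewrite coef_poly ltnS kN.
Qed.

Lemma sum_expr_multinomial (I : finType) (x : I -> K) (N k : nat) : (k <= N)%N ->
  (\sum_i x i) ^+ k = k`!%:R *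
  \sum_(f : {ffun I -> 'I_N.+1} | (\sum_i f i)%N == k)
     \prod_i (x i ^+ f i / (f i)`!%:R).
Proof.
move=> kN; rewrite -[LHS](mulfVK (natr_fact_neq0 k)) -(coef_prod_exp x kN) mulrC.
congr (_ * _).
under eq_bigr do rewrite poly_def.
rewrite bigA_distr_bigA coef_sum [RHS]big_mkcond; apply: eq_bigr => f _.
under eq_bigr do rewrite -mul_polyC.
rewrite big_split /= -rmorph_prod /= mul_polyC coefZ.
rewrite (eq_bigr (fun i => 'X ^+ f i))// prodrXr coefXn eq_sym.
by case: eqP; rewrite ?mulr1 ?mulr0.
Qed.

Lemma pochhammer_neg (n k : nat) :
  pochhammer (- n%:R) k = (-1) ^+ k * ('C(n, k) * k`!)%:R :> K.
Proof.
rewrite bin_ffact; elim: k => [|k IH]; first by rewrite pochhammer0 expr0 mul1r ffactn0.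
rewrite pochhammerSr IH ffactnSr exprS.
case: (ltnP n k) => nk; first by rewrite ffact_small// mul0n !mulr0 mul0r.
by rewrite natrM natrB//; ring.
Qed.

Lemma pochhammer_neg_small (n k : nat) : (n < k)%N ->
  pochhammer (- n%:R) k = 0 :> K.
Proof. by move=> nk; rewrite pochhammer_neg bin_small// mul0n mulr0. Qed.

Lemma pochhammer_neg_le (n k : nat) : (k <= n)%N ->
  pochhammer (- n%:R) k = (-1) ^+ k * n`!%:R / (n - k)`!%:R :> K.
Proof.
move=> kn; rewrite pochhammer_neg -(bin_fact kn) mulnA [in RHS]natrM mulrA mulfK// natr_fact_neq0.
Qed.

Lemma pochhammerSl (x : K) k : pochhammer x k.+1 = x * pochhammer (x + 1) k.
Proof.
rewrite /pochhammer big_ord_recl addr0; congr (_ * _).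
by apply: eq_bigr => i _; rewrite -addrA nat1r.
Qed.

Lemma pochhammerD (x : K) j k :
  pochhammer x (j + k) = pochhammer x j * pochhammer (x + j%:R) k.
Proof.
elim: k => [|k IH]; first by rewrite addn0 pochhammer0 mulr1.
by rewrite addnS !pochhammerSr IH natrD addrA mulrA.
Qed.

(** Terms with [\sum_i f i > n], where the exponent of [y] is truncated, vanish with
    the rising factorial; summing over all [f] bounded by a common [N] lets the
    expansions for several [n] be multiplied. *)
Lemma subr_expr_multinomial (I : finType) (y : K) (x : I -> K) (N n : nat) :
  (n <= N)%N ->
  (y - \sum_i x i) ^+ n =
  \sum_(f : {ffun I -> 'I_N.+1})
     pochhammer (- n%:R) (\sum_i f i)%N * y ^+ (n - \sum_i f i) *
     \prod_i (x i ^+ f i / (f i)`!%:R).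
Proof.
move=> nN; rewrite exprDn.
rewrite (partition_big (fun f : {ffun I -> 'I_N.+1} => inord (\sum_i f i) : 'I_n.+1)
  xpredT)//=.
apply: eq_bigr => k _; have kn : (k <= n)%N by rewrite -ltnS.
rewrite exprNn (sum_expr_multinomial x (leq_trans kn nN)).
rewrite -mulr_natr !mulr_sumr mulr_suml big_mkcond [RHS]big_mkcond /=.
apply: eq_bigr => f _.
case: (leqP (\sum_i f i) n) => fn; last first.
  rewrite pochhammer_neg_small// !mul0r; case: ifP => [/eqP fk|_]; last by case: ifP.
  by move: fn; rewrite fk ltnNge kn.
rewrite -val_eqE /= inordK ?ltnS//; case: eqP => // ->.
by rewrite pochhammer_neg natrM; ring.
Qed.

(** Truncating the binomial series of [(1 - y) ^ -t] to degree [M] is done by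
    raising the truncated geometric series to the power [t]. *)
Lemma coef_geom_expr (M t k : nat) : (k <= M)%N ->
  ((\sum_(i < M.+1) 'X^i : {poly K}) ^+ t)`_k = pochhammer t%:R k / k`!%:R.
Proof.
have coefG i : (i <= M)%N -> (\sum_(i < M.+1) 'X^i : {poly K})`_i = 1.
  move=> iM; rewrite coef_sum (bigD1 (inord i))//= coefXn inordK ?ltnS// eqxx.
  rewrite big1 ?addr0// => j; rewrite -val_eqE /= inordK ?ltnS// => ji.
  by rewrite coefXn eq_sym (negbTE ji).
elim: t k => [|t IH] k kM.
  rewrite expr0 coef1; case: k kM => [|k] _; first by rewrite pochhammer0 divr1.
  by rewrite pochhammerSl !mul0r.
rewrite exprSr coefM.
under eq_bigr => i _.
  rewrite coefG ?(leq_trans (leq_subr _ _))// mulr1 IH; last first.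
    by rewrite (leq_trans _ kM)// -ltnS.
  over.
elim: k {kM} => [|k IHk].
  by rewrite big_ord_recr big_ord0 /= !pochhammer0 add0r.
rewrite big_ord_recr /= IHk pochhammerSl pochhammerSr -natr1 factS natrM.
have := natr_fact_neq0 k; move: (k`!%:R) => f f0.
have k0 : k%:R + 1 != 0 :> K by rewrite natr1 pnatr_eq0.
by rewrite -(natr1 k); field; rewrite f0 k0.
Qed.

(** Telescoping; bounding all powers by [L ^+ t] keeps the induction simple. *)
Lemma normr_exprB_le (x y L : K) t : `|x| <= L -> `|y| <= L -> 1 <= L ->
  `|x ^+ t - y ^+ t| <= t%:R * L ^+ t * `|x - y|.
Proof.
move=> xL yL L1; have L0 : 0 <= L := le_trans ler01 L1.
elim: t => [|t IH]; first by rewrite !expr0 subrr normr0 !mul0r.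
have -> : x ^+ t.+1 - y ^+ t.+1 = x * (x ^+ t - y ^+ t) + y ^+ t * (x - y).
  by rewrite !exprS; ring.
rewrite (le_trans (ler_normD _ _))// !normrM -natr1 mulrDl mulrDl mul1r lerD//.
  rewrite exprS (mulrCA _ L) -!mulrA ler_pM// ?mulrA//.
rewrite ler_wpM2r// normrX exprS (le_trans _ (ler_peMl _ L1)) ?exprn_ge0//.
by rewrite lerXn2r// nnegrE.
Qed.

Lemma geom_expr_approx (y r : K) M t : `|y| <= r -> r < 1 ->
  `|(\sum_(i < M.+1) y ^+ i) ^+ t - (1 - y) ^- t| <=
  t%:R * ((1 - r)^-1) ^+ t.+1 * r ^+ M.+1.
Proof.
move=> yr r1; have r0 : 0 <= r := le_trans (normr_ge0 y) yr.
have r10 : 0 < 1 - r by rewrite subr_gt0.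
have lb : 1 - r <= `|1 - y|.
  by rewrite (le_trans _ (lerB_dist _ _))// normr1 lerD2l lerN2.
have y10 : 1 - y != 0 by rewrite -normr_gt0 (lt_le_trans r10).
have Vle : `|(1 - y)^-1| <= (1 - r)^-1.
  by rewrite normfV lef_pV2// posrE ?normr_gt0.
have geo (z : K) : (1 - z) * (\sum_(i < M.+1) z ^+ i) = 1 - z ^+ M.+1.
  by rewrite -[RHS]opprB subrX1 -mulNr opprB.
have Gle : `|\sum_(i < M.+1) y ^+ i| <= (1 - r)^-1.
  rewrite (le_trans (ler_norm_sum _ _ _))//.
  rewrite (@le_trans _ _ (\sum_(i < M.+1) r ^+ i))//.
    by apply: ler_sum => i _; rewrite normrX lerXn2r// nnegrE.
  rewrite -[leRHS]mulr1 mulrC ler_pdivlMr// mulrC geo gerBl exprn_ge0//.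
have L1 : 1 <= (1 - r)^-1 by rewrite invf_ge1// gerBl.
rewrite -exprVn (le_trans (normr_exprB_le t Gle Vle L1))//.
rewrite exprSr -!mulrA ler_wpM2l// ler_wpM2l ?exprn_ge0 ?invr_ge0 ?(ltW r10)//.
have -> : \sum_(i < M.+1) y ^+ i - (1 - y)^-1 = - (y ^+ M.+1 * (1 - y)^-1).
  apply: (mulfI y10); rewrite mulrBr geo mulfV// mulrN mulrCA mulfV//; ring.
by rewrite normrN normrM mulrC ler_pM// normrX lerXn2r// nnegrE.
Qed.

End divided_powers.

(** * Taylor coefficients of powers of the kernel *)

Section geometric_limit.
Import numFieldNormedType.Exports.

Lemma eq0_geometric (R : realType) (x L r : R) (N0 : nat) : 0 <= x -> 0 <= r < 1 -> 0 <= L ->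
  (forall N, (N0 <= N)%N -> x <= L * r ^+ N) -> x = 0.
Proof.
move=> x0 /andP[r0 r1] L0 H; apply/eqP; rewrite eq_le x0 andbT leNgt; apply/negP => xgt.
have cv : (fun n => L * r ^+ n) @ \oo --> (L * 0 : R).
  by apply: cvgMr; apply: cvg_expr; rewrite ger0_norm.
have : \forall n \near \oo, L * r ^+ n < x.
  by apply: (cvgr_lt (L * 0)) => //; rewrite mulr0.
case=> N1 _ /(_ (maxn N0 N1) (leq_maxr _ _)).
by rewrite ltNge H// leq_maxl.
Qed.

End geometric_limit.

Lemma normcX (R : rcfType) (z : R[i]) n :
  Normc.normc (z ^+ n) = Normc.normc z ^+ n.
Proof.
elim: n => [|n IH]; first by rewrite !expr0 Normc.normc1.
by rewrite !exprS Normc.normcM IH.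
Qed.

Section dot_monomial.
Context {R : realType} (d b : nat) (m : {ffun 'I_d -> nat}).
Local Notation C := R[i].
Local Notation plane := (measurableTypeR R * measurableTypeR R)%type.
Local Notation normc := Normc.normc.
Implicit Types (f g : 'cV[C]_d -> C) (t : d.-tuple plane).
Local Notation B := (@unit_ball R d).

Definition dot_mono f := bergman_dot b f (fun z => mi_pow z m).

Lemma dot_monoE f : dot_mono f = ball_integral (fun z => f z *
  (conjc (mi_pow z m) * (bergman_const d b * (1 - cnorm z ^+ 2) ^+ b)%:C)).
Proof. by congr ball_integral; apply/funext => z; rewrite mulrA. Qed.

Lemma ball_bmeas_dot_weight : ball_bmeas (fun z : 'cV[C]_d =>
  conjc (mi_pow z m) * (bergman_const d b * (1 - cnorm z ^+ 2) ^+ b)%:C).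
Proof.
apply: ball_bmeasM; first by apply: ball_bmeas_conj; exact: ball_bmeas_mi_pow.
under eq_fun do rewrite rmorphM /=; apply: ball_bmeasM; first exact: ball_bmeas_cst.
exact: ball_bmeas_weight.
Qed.

Lemma dot_monoZ (x : C) f : ball_bmeas f -> dot_mono (fun z => x * f z) = x * dot_mono f.
Proof.
move=> nf; rewrite !dot_monoE -ball_integralZ; last first.
  by apply: ball_bmeasM => //; exact: ball_bmeas_dot_weight.
by congr ball_integral; apply/funext => z; rewrite -mulrA.
Qed.

Lemma dot_monoB f g : ball_bmeas f -> ball_bmeas g ->
  dot_mono (fun z => f z - g z) = dot_mono f - dot_mono g.
Proof.
move=> nf ng; have nw := ball_bmeas_dot_weight.
rewrite -[- dot_mono g]mulN1r -dot_monoZ// !dot_monoE -ball_integralD.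
- by congr ball_integral; apply/funext => z; rewrite mulrDl mulN1r.
- exact: ball_bmeasM.
- by apply: ball_bmeasM => //; apply: ball_bmeasM => //; exact: ball_bmeas_cst.
Qed.

Lemma dot_mono_sum (I : Type) (s : seq I) (P : pred I)
    (F : I -> 'cV[C]_d -> C) : (forall i, ball_bmeas (F i)) ->
  dot_mono (fun z => \sum_(i <- s | P i) F i z) =
  \sum_(i <- s | P i) dot_mono (F i).
Proof.
move=> nF; have nw := ball_bmeas_dot_weight.
under eq_bigr do rewrite dot_monoE.
rewrite dot_monoE -ball_integral_sum; last by move=> i; exact: ball_bmeasM.
by congr ball_integral; apply/funext => z; rewrite mulr_suml.
Qed.

(** Uniform convergence on the ball passes to the pairings with a monomial. *)
Lemma dot_mono_bounded : exists2 L : R, 0 <= L & forall f e, ball_bmeas f ->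
  (forall t, B t -> normc (f (cvec t)) <= e) -> normc (dot_mono f) <= L * e.
Proof.
have nw := ball_bmeas_dot_weight; have [_ _ [K wK]] := nw.
have V0 : 0 <= fine (@volume R d B) by rewrite fine_ge0.
exists (2 * (`|K| * fine (@volume R d B))); first by rewrite !mulr_ge0.
move=> f e nf fe.
rewrite dot_monoE (_ : _ * e = 2 * (e * `|K| * fine (volume d B))); last by ring.
apply: ball_integral_le; first exact: ball_bmeasM.
move=> t tB; rewrite Normc.normcM ler_pM ?normc_ge0 ?fe//.
by rewrite (le_trans (wK _ tB))// ler_norm.
Qed.

Definition sqnorm_mono : R :=
  (mi_fact m)%:R / pochhammer (b + d).+1%:R (mi_sum m).

Lemma dot_mono_mi_pow p : dot_mono (fun z => mi_pow z p) = (p == m)%:R * sqnorm_mono%:C.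
Proof.
by rewrite /dot_mono bergman_dot_monomial; case: eqP; rewrite ?mul1r ?mul0r.
Qed.

End dot_monomial.

Section kernel.
Context {R : realType} (d b : nat) (m s : {ffun 'I_d -> nat}).
Local Notation C := R[i].
Local Notation plane := (measurableTypeR R * measurableTypeR R)%type.
Local Notation normc := Normc.normc.
Local Notation B := (@unit_ball R d).
Variable c : 'cV[C]_d.

Definition cdot (z : 'cV[C]_d) : C := \sum_j c j 0 * z j 0.

Lemma ball_bmeas_cdot : ball_bmeas cdot.
Proof.
apply: ball_bmeas_sum => j; apply: ball_bmeasM; first exact: ball_bmeas_cst.
exact: ball_bmeas_coord.
Qed.

Definition mi_le (p q : {ffun 'I_d -> nat}) := [forall j, (p j <= q j)%N].

(** Of the multinomial expansion of the power, orthogonality keeps the single term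
    whose exponents are the differences [m j - s j]. *)
Lemma dot_mono_cdot_expr (N : nat) :
  dot_mono b m (fun z => cdot z ^+ N * mi_pow z s) =
  (mi_le s m && (N == mi_sum m - mi_sum s)%N)%:R *
  (N`!%:R * (\prod_j (c j 0 ^+ (m j - s j) / (m j - s j)`!%:R))) *
  (sqnorm_mono b m)%:C.
Proof.
pose co (f : {ffun 'I_d -> 'I_N.+1}) : C := \prod_i (c i 0 ^+ f i / (f i)`!%:R).
pose sh (f : {ffun 'I_d -> 'I_N.+1}) : {ffun 'I_d -> nat} := [ffun j => (f j + s j)%N].
have -> : dot_mono b m (fun z => cdot z ^+ N * mi_pow z s) =
    N`!%:R * (\sum_(f : {ffun 'I_d -> 'I_N.+1} | (\sum_i f i)%N == N)
      (co f * (sh f == m)%:R)) * (sqnorm_mono b m)%:C.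
  have key f : co f * (sh f == m)%:R * (sqnorm_mono b m)%:C =
      dot_mono b m (fun z => co f * mi_pow z (sh f)).
    by rewrite dot_monoZ ?dot_mono_mi_pow ?mulrA//; exact: ball_bmeas_mi_pow.
  rewrite -mulrA mulr_suml (eq_bigr _ (fun f _ => key f)).
  have nI (f : {ffun 'I_d -> 'I_N.+1}) : ball_bmeas (fun z : 'cV[C]_d => co f * mi_pow z (sh f)).
    by apply: ball_bmeasM; [exact: ball_bmeas_cst|exact: ball_bmeas_mi_pow].
  rewrite -dot_mono_sum// -dot_monoZ; last exact: ball_bmeas_sum.
  congr bergman_dot; apply/funext => z.
  rewrite /cdot (sum_expr_multinomial _ (leqnn N)) -mulrA mulr_suml.
  congr (_ * _); apply: eq_bigr => f _.
  rewrite /co /mi_pow -!big_split /=; apply: eq_bigr => i _.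
  by rewrite ffunE exprD exprMn; ring.
congr (_ * _); rewrite mulrCA; congr (_ * _).
case: (boolP (mi_le s m && _)) => [/andP[/forallP sm /eqP NE]|H]; last first.
  rewrite mul0r big1// => f /eqP fN; case: eqP => [fm|]; rewrite ?mulr0//.
  case/negP: H; have fE j : m j = (f j + s j)%N by rewrite -fm ffunE.
  apply/andP; split; first by apply/forallP => j; rewrite fE leq_addl.
  rewrite /mi_sum (eq_bigr _ (fun j _ => fE j)) big_split /= addnK.
  by rewrite fN.
have sumE : (\sum_j (m j - s j))%N = N.
  rewrite NE /mi_sum -[X in (X - _)%N](eq_bigr _ (fun j _ => subnK (sm j))).
  by rewrite big_split /= addnK.
have leN j : (m j - s j <= N)%N by rewrite -sumE (bigD1 j)//= leq_addr.
pose f0 : {ffun 'I_d -> 'I_N.+1} := [ffun j => inord (m j - s j)].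
have f0E j : f0 j = (m j - s j)%N :> nat by rewrite ffunE inordK// ltnS.
have shf0 : sh f0 = m.
  by apply/ffunP => j; rewrite [LHS]ffunE f0E subnK.
rewrite (bigD1 f0)/=; last first.
  by apply/eqP; rewrite -[RHS]sumE; apply: eq_bigr => j _; exact: f0E.
rewrite shf0 eqxx mulr1 mul1r big1 ?addr0.
  by apply: eq_bigr => j _; rewrite f0E.
move=> f /andP[_ ff0]; case: eqP => [fm|]; rewrite ?mulr0//.
case/eqP: ff0; apply/ffunP => j; apply: ord_inj; rewrite f0E -fm ffunE.
by rewrite addnK.
Qed.

Variable a : C.
Hypothesis ca : \sum_j normc (c j 0) ^+ 2 < normc a ^+ 2.

Lemma normc_a_gt0 : 0 < normc a.
Proof.
rewrite lt_neqAle normc_ge0 andbT; apply/eqP => a0; move: ca.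
rewrite -a0 expr0n /= ltNge sumr_ge0// => j _; exact: sqr_ge0.
Qed.

Lemma kernel_center_neq0 : a != 0.
Proof. by apply/eqP => a0; move: normc_a_gt0; rewrite a0 Normc.normc0 ltxx. Qed.

(** Weighted arithmetic-geometric inequality in place of Cauchy-Schwarz: the bound
    [(S / |a|^2 + 1) / 2] needs no square root and is still smaller than 1. *)
Lemma kernel_contraction : exists r : R, [/\ 0 <= r, r < 1 &
  forall t, B t -> normc (- (cdot (cvec t) / a)) <= r].
Proof.
have a0 := normc_a_gt0.
pose S := \sum_j normc (c j 0) ^+ 2.
have S0 : 0 <= S by apply: sumr_ge0 => j _; exact: sqr_ge0.
exists ((S / normc a ^+ 2 + 1) / 2).
have Sa : S / normc a ^+ 2 < 1 by rewrite ltr_pdivrMr ?exprn_gt0// mul1r; exact: ca.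
have Sa0 : 0 <= S / normc a ^+ 2 by rewrite divr_ge0// exprn_ge0// ltW.
split; [lra|lra|] => t; rewrite /unit_ball /= => tB.
rewrite -mulNr Normc.normcM Normc.normcV normcN ler_pdivrMr//.
have Z1 : \sum_j normc (cvec t j 0) ^+ 2 <= 1.
  rewrite -(@sqr_sqrtr _ (\sum_j _)); last by apply: sumr_ge0 => j _; exact: sqr_ge0.
  by rewrite expr_le1 ?sqrtr_ge0// ltW.
(* The weight [normc a] balances the two sums, whose bounds are then
   [S / normc a] and [normc a]. *)
have step : normc (cdot (cvec t)) <=
    \sum_j (normc (c j 0) ^+ 2 / normc a + normc (cvec t j 0) ^+ 2 * normc a) / 2.
  rewrite /cdot; apply: (big_ind2 (fun x y => normc x <= y)).
  - by rewrite Normc.normc0.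
  - by move=> x1 x2 y1 y2 h1 h2; rewrite (le_trans (le_normcD _ _))// lerD.
  move=> j _; rewrite Normc.normcM.
  move: (normc (c j 0)) (normc (cvec t j 0)) => u v.
  have := sqr_ge0 (u - v * normc a); move: (normc a) a0 => n n0 h.
  have -> : (u ^+ 2 / n + v ^+ 2 * n) / 2 = u * v + (u - v * n) ^+ 2 / (2 * n).
    by field; rewrite gt_eqF.
  by rewrite lerDl divr_ge0// mulr_ge0// ltW.
apply: (le_trans step); rewrite -mulr_suml big_split /= -!mulr_suml -/S.
have -> : (S / normc a ^+ 2 + 1) / 2 * normc a = (S / normc a + 1 * normc a) / 2.
  by field; rewrite gt_eqF.
by rewrite ler_pM2r// lerD2l ler_pM2r.
Qed.

Lemma ball_bmeas_kernel t : ball_bmeas (fun z => (a + cdot z) ^- t).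
Proof.
have [r [r0 r1 cr]] := kernel_contraction; have a0 := normc_a_gt0.
under eq_fun do rewrite -exprVn.
apply: ball_bmeasX; apply: (@ball_bmeasV _ _ _ (normc a * (1 - r))).
- by rewrite mulr_gt0// subr_gt0.
- move=> z zB; have -> : a + cdot (cvec z) = a * (1 - - (cdot (cvec z) / a)).
    by field; exact: kernel_center_neq0.
  rewrite Normc.normcM ler_pM2l// lerBlDr.
  have := cr z zB; set y := - _ => yr.
  rewrite -(Normc.normc1 R) (le_trans _ (lerD (lexx _) yr))//.
  by rewrite -{1}(subrK y 1) le_normcD.
- by apply: ball_bmeasD; [exact: ball_bmeas_cst|exact: ball_bmeas_cdot].
Qed.

(** Coefficient extraction from a power of the kernel: replacing the power by
    the geometric truncation commits an error which is exponentially small on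
    the whole ball, while the truncations of degree at least [k] all have the same
    pairing with the monomial. *)
Lemma dot_mono_kernel t :
  dot_mono b m (fun z => (a + cdot z) ^- t * mi_pow z s) =
  let k := (mi_sum m - mi_sum s)%N in
  (mi_le s m)%:R * (a ^- (t + k) * (-1) ^+ k * pochhammer t%:R k *
  \prod_j (c j 0 ^+ (m j - s j) / (m j - s j)`!%:R)) * (sqnorm_mono b m)%:C.
Proof.
set k := (mi_sum m - mi_sum s)%N; rewrite /=; set V := RHS.
have a0 := kernel_center_neq0; have na0 := normc_a_gt0.
have [r [r0 r1 cr]] := kernel_contraction.
have [L L0 Lb] := @dot_mono_bounded R d b m.
have nk := ball_bmeas_kernel t; have ns := ball_bmeas_mi_pow s.
have [_ _ [S sS]] := @ball_bmeas_mi_pow R d s.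
pose G (M : nat) : {poly C} := (\sum_(i < M.+1) 'X^i) ^+ t.
pose y (z : 'cV[C]_d) : C := - (cdot z / a).
pose g M z := a ^- t * (G M).[y z] * mi_pow z s.
have gE M z : g M z = \sum_(i < size (G M))
    (a ^- t * (G M)`_i * (- a^-1) ^+ i) * (cdot z ^+ i * mi_pow z s).
  rewrite /g horner_coef mulr_sumr mulr_suml; apply: eq_bigr => i _.
  by rewrite /y -mulrN exprMn; ring.
have nci i : ball_bmeas (fun z => cdot z ^+ i * mi_pow z s).
  by apply: ball_bmeasM => //; apply: ball_bmeasX; exact: ball_bmeas_cdot.
have ng M : ball_bmeas (g M).
  rewrite (funext (gE M)); apply: ball_bmeas_sum => i.
  by apply: ball_bmeasM; [exact: ball_bmeas_cst|].
have gV M : (k <= M)%N -> dot_mono b m (g M) = V.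
  move=> kM; rewrite (funext (gE M)) dot_mono_sum; last first.
    by move=> i; apply: ball_bmeasM; [exact: ball_bmeas_cst|].
  under eq_bigr do rewrite dot_monoZ// dot_mono_cdot_expr.
  rewrite /V; case: (mi_le s m); last first.
    by rewrite !mul0r big1// => i _; rewrite !mul0r mulr0.
  rewrite mul1r.
  transitivity (a ^- t * (G M)`_k * (- a^-1) ^+ k * (k`!%:R *
    (\prod_j (c j 0 ^+ (m j - s j) / (m j - s j)`!%:R)) * (sqnorm_mono b m)%:C)).
    case: (ltnP k (size (G M))) => kG.
      rewrite (bigD1 (Ordinal kG))//= eqxx mul1r [X in _ + X]big1 ?addr0// => i.
      by rewrite -val_eqE /= => /negbTE ->; rewrite !mul0r mulr0.
    rewrite [in RHS]nth_default// mulr0 !mul0r big1// => i _.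
    rewrite (_ : (i : nat) == _ = false) ?mul0r ?mulr0//.
    by apply/negbTE; rewrite neq_ltn (leq_trans (ltn_ord i) kG).
  have nak : (- a^-1) ^+ k = (-1) ^+ k * a ^- k by rewrite -(mulN1r a^-1) exprMn exprVn.
  rewrite /G coef_geom_expr// nak exprD invfM.
  have := natr_fact_neq0 C k; move: (k`!%:R) (a ^- t) (a ^- k) => F X Y F0.
  by field; rewrite F0.
set J := dot_mono b m _.
suff : normc (J - V) = 0 by move=> /Normc.eq0_normc/eqP; rewrite subr_eq0 => /eqP.
pose e (M : nat) : R := normc a ^- t * (t%:R * (1 - r)^-1 ^+ t.+1 * r ^+ M.+1) * `|S|.
apply: (@eq0_geometric R _ (L * (normc a ^- t * (t%:R * (1 - r)^-1 ^+ t.+1 * r) * `|S|)) r k).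
- exact: normc_ge0.
- by rewrite r0 r1.
- by rewrite !mulr_ge0 ?invr_ge0 ?exprn_ge0 ?invr_ge0 ?subr_ge0 ?normc_ge0 // ltW.
move=> M kM; rewrite -(gV M kM) /J -dot_monoB//; last exact: ball_bmeasM.
apply: (le_trans (Lb _ (e M) _ _)).
- rewrite (_ : (fun z => _) = (fun z => (a + cdot z) ^- t * mi_pow z s + (-1) * g M z)).
    apply: ball_bmeasD; first by apply: ball_bmeasM; [exact: nk|exact: ns].
    by apply: ball_bmeasM; [exact: ball_bmeas_cst|exact: ng].
  by apply/funext => z; rewrite mulN1r.
- move=> z zB; rewrite /g -mulrBl Normc.normcM ler_pM ?normc_ge0//; last first.
    by rewrite (le_trans (sS _ zB))// ler_norm.
  have -> : a + cdot (cvec z) = a * (1 - y (cvec z)).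
    by rewrite /y; field.
  rewrite exprMn invfM -mulrBr Normc.normcM Normc.normcV normcX ler_pM2l ?invr_gt0 ?exprn_gt0//.
  rewrite /G horner_exp horner_sum.
  under eq_bigr do rewrite hornerXn.
  rewrite -normcN opprB -lecR.
  rewrite !(rmorphM, rmorphXn, rmorphV) /=.
  apply: (le_trans (@geom_expr_approx C (y (cvec z)) r%:C M t _ _)).
  - by rewrite lecR; exact: cr.
  - by rewrite -(rmorph1 (real_complex R)) ltcR.
  - by rewrite rmorph_nat rmorphB rmorph1.
  by rewrite unitfE subr_eq0 gt_eqF.
by rewrite le_eqVlt; apply/orP; left; apply/eqP; rewrite /e (exprS r M); ring.
Qed.

End kernel.

(** * The combinatorial summand *)

(** The upper left entry of the equation [g^* J g = J]. *)
Lemma SU1_normc (R : realType) (d : nat) (a : R[i]) (b c : 'cV[R[i]]_d) D :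
  SU1 (block_mx a%:M b^T c D) ->
  Normc.normc a ^+ 2 = 1 + \sum_j Normc.normc (c j 0) ^+ 2.
Proof.
case=> _; rewrite map_block_mx tr_block_mx /Jmx !mulmx_block.
move=> /(congr1 (@ulsubmx _ 1 d 1 d)); rewrite !block_mxKul.
rewrite !mulmx0 !addr0 !add0r mulmx1 mulmxN mulmx1 mulNmx.
move=> /matrixP/(_ 0 0); rewrite !mxE big_ord1 !mxE mulr1n /= => E.
apply: (@complexI R); rewrite rmorphD rmorph_sum rmorph1 rmorphXn /=.
rewrite -[(Normc.normc a)%:C]/`|a| sqr_normc mulrC -[LHS](subrK (\sum_j (map_mx conjc c)^T 0 j * c j 0)).
rewrite E; congr (_ + _); apply: eq_bigr => j _.
by rewrite !mxE rmorphXn /= -[(Normc.normc _)%:C]/`|c j 0| sqr_normc mulrC.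
Qed.

Section matrix_sum.
Variables (d N : nat).

Definition ffun_mx (A : {ffun 'I_d -> {ffun 'I_d -> 'I_N.+1}}) : 'M[nat]_d :=
  \matrix_(i, j) (A i j : nat).

(** The index set constrains only some rows and columns, hence may be infinite; the
    sum is finite because the summand vanishes outside a box. *)
Lemma fsum_bounded_mx (K : nmodType) (P : set 'M[nat]_d) (G : 'M[nat]_d -> K) :
  (forall X, P X -> G X != 0 -> forall i j, (X i j <= N)%N) ->
  \sum_(X \in P) G X =
  \sum_(A : {ffun 'I_d -> {ffun 'I_d -> 'I_N.+1}})
     (if ffun_mx A \in P then G (ffun_mx A) else 0).
Proof.
move=> GN; have injM : injective ffun_mx.
  move=> A A' /matrixP AA; apply/ffunP => i; apply/ffunP => j; apply: val_inj.
  by have := AA i j; rewrite !mxE.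
rewrite (@fsbigE _ _ _ _ P [seq ffun_mx A | A <- enum {ffun 'I_d -> {ffun 'I_d -> 'I_N.+1}} & ffun_mx A \in P]).
- rewrite big_map big_filter_cond big_enum_cond [LHS]big_mkcond /=.
  by apply: eq_bigr => A _; rewrite andbb.
- by rewrite map_inj_uniq// filter_uniq// enum_uniq.
- by move=> X /= /mapP[A]; rewrite mem_filter => /andP[/set_mem AP _] ->.
- move=> X PX; apply: contraNeq => /(GN X PX) XN; apply/mapP.
  have XE : ffun_mx [ffun i => [ffun j => inord (X i j)]] = X.
    by apply/matrixP => i j; rewrite !mxE !ffunE inordK// ltnS.
  exists [ffun i => [ffun j => inord (X i j)]]; last by rewrite XE.
  by rewrite mem_filter XE mem_enum andbT; exact/mem_set.
Qed.

End matrix_sum.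

Section summand.
Variables (K : numFieldType) (d sigma k l : nat).
Variables (a : K) (b c : 'cV[K]_d) (D : 'M[K]_d).
Hypothesis hsigma : (0 < sigma)%N.
Hypothesis hb : forall i : 'I_d, (i < k)%N -> b i 0 != 0.
Hypothesis hb0 : forall i : 'I_d, (k <= i)%N -> b i 0 = 0.
Hypothesis hc : forall j : 'I_d, (j < l)%N -> c j 0 != 0.
Hypothesis hc0 : forall j : 'I_d, (l <= j)%N -> c j 0 = 0.
Variables (m n : {ffun 'I_d -> nat}) (X : 'M[nat]_d).
Local Notation r i := (\sum_j X i j)%N.
Local Notation s j := (\sum_i X i j)%N.

(** What remains of [b i 0 * c j 0 - a * D j i] once the nonzero ones among
    [b i 0] and [c j 0] are factored out. *)
Definition scaled_entry (i j : 'I_d) : K :=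
  if (j < l)%N then
    if (i < k)%N then 1 - a * D j i / (b i 0 * c j 0) else - (a * D j i / c j 0)
  else if (i < k)%N then - (a * D j i / b i 0) else - (a * D j i).

Lemma scaled_entryE i j : b i 0 * c j 0 - a * D j i =
  (if (i < k)%N then b i 0 else 1) * (if (j < l)%N then c j 0 else 1) *
  scaled_entry i j.
Proof.
rewrite /scaled_entry; case: (ltnP i k) => ik; case: (ltnP j l) => jl.
- by field; rewrite hb// hc.
- by rewrite hc0//; field; rewrite hb.
- by rewrite hb0//; field; rewrite hc.
- by rewrite hb0// mul0r !mul1r sub0r.
Qed.

Lemma scaled_entry_prod :
  (\prod_(j < d | (j < l)%N)
            ((\prod_(i < d | (i < k)%N)
                (1 - a * D j i / (b i 0 * c j 0)) ^+ X i j)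
             * (\prod_(i < d | (k <= i)%N)
                (- (a * D j i / c j 0)) ^+ X i j)))
       * (\prod_(j < d | (l <= j)%N)
            ((\prod_(i < d | (i < k)%N)
                (- (a * D j i / b i 0)) ^+ X i j)
             * (\prod_(i < d | (k <= i)%N)
                (- (a * D j i)) ^+ X i j))) =
  \prod_i \prod_j scaled_entry i j ^+ X i j.
Proof.
rewrite exchange_big [RHS](bigID (fun j : 'I_d => (j < l)%N)) /=.
congr (_ * _).
- apply: eq_bigr => j jl; rewrite [RHS](bigID (fun i : 'I_d => (i < k)%N)) /=.
  congr (_ * _).
    by apply: eq_bigr => i ik; rewrite /scaled_entry jl ik.
  under [RHS]eq_bigl do rewrite -leqNgt.
  by apply: eq_bigr => i ik; rewrite /scaled_entry jl ltnNge ik.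
- under [RHS]eq_bigl do rewrite -leqNgt.
  apply: eq_bigr => j jl; rewrite [RHS](bigID (fun i : 'I_d => (i < k)%N)) /=.
  congr (_ * _).
    by apply: eq_bigr => i ik; rewrite /scaled_entry ltnNge jl ik.
  under [RHS]eq_bigl do rewrite -leqNgt.
  by apply: eq_bigr => i ik; rewrite /scaled_entry !ltnNge jl ik.
Qed.

(** Past the index [h] the base is 0, and [0 ^+ (e i - u i)] tests [u i = e i]. *)
Lemma prod_expr_support (h : nat) (x : 'cV[K]_d) (e u : 'I_d -> nat) :
  (forall i, (u i <= e i)%N) -> (forall i : 'I_d, (h <= i)%N -> x i 0 = 0) ->
  (\prod_(i < d) x i 0 ^+ (e i - u i)) * \prod_(i < d) (if (i < h)%N then x i 0 else 1) ^+ u i =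
  [forall i : 'I_d, (h <= i)%N ==> (u i == e i)]%:R *
    \prod_(i < d | (i < h)%N) x i 0 ^+ e i.
Proof.
move=> ue x0; rewrite -big_split /=.
case: (boolP [forall i, _]) => [/forall_inP eqs|].
  rewrite mul1r [RHS]big_mkcond; apply: eq_bigr => i _.
  case: (ltnP i h) => ih; first by rewrite -exprD subnK.
  by rewrite (eqP (eqs i ih)) subnn expr1n mulr1.
rewrite negb_forall_in => /existsP[i /andP[hi ne]].
rewrite mul0r (bigD1 i)//= x0// expr0n subn_eq0 leqNgt.
by rewrite ltn_neqAle ne ue !mul0r.
Qed.

(** If some row sum exceeds [n i] or some column sum exceeds [m j], both sides vanish
    with a rising factorial of a negative integer.  Otherwise the truncated
    subtractions are exact and the sides agree factor by factor. *)
Lemma summandE :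
  a ^- mi_sum n * (\prod_i (pochhammer (- (n i)%:R) (r i) * b i 0 ^+ (n i - r i))) *
  (\prod_i \prod_j ((b i 0 * c j 0 - a * D j i) ^+ X i j / (X i j)`!%:R)) *
  ([forall j : 'I_d, (s j <= m j)%N]%:R *
   (a ^- (sigma + \sum_i r i + (mi_sum m - \sum_i r i)) *
    (-1) ^+ (mi_sum m - \sum_i r i) *
    pochhammer (sigma + \sum_i r i)%:R (mi_sum m - \sum_i r i) *
    \prod_j (c j 0 ^+ (m j - s j) / (m j - s j)`!%:R))) *
  ((mi_fact m)%:R / pochhammer sigma%:R (mi_sum m)) =
  (-1) ^+ mi_sum m * a ^- (sigma + mi_sum m + mi_sum n)
  * (\prod_(i < d | (i < k)%N) b i 0 ^+ n i)
  * (\prod_(j < d | (j < l)%N) c j 0 ^+ m j) *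
  (if X \in index_mx k l m n then
   (\prod_(j < d) pochhammer (- (m j)%:R) (\sum_(i < d) X i j)%N)
       * (\prod_(i < d) pochhammer (- (n i)%:R) (\sum_(j < d) X i j)%N)
       / pochhammer sigma%:R (\sum_(i < d) \sum_(j < d) X i j)%N
       * (\prod_(i < d) \prod_(j < d) ((X i j)`!)%:R^-1)
       * (\prod_i \prod_j scaled_entry i j ^+ X i j) else 0).
Proof.
case: (boolP [forall i : 'I_d, (r i <= n i)%N]) => [/forallP rn|]; last first.
  move=> /forallPn[ i ]; rewrite -ltnNge => ni.
  have z1 : \prod_i pochhammer (- (n i)%:R) (r i) = 0 :> K.
    by rewrite (bigD1 i)//= pochhammer_neg_small// mul0r.
  rewrite big_split /= z1 !(mul0r, mulr0).
  by case: ifP => _; rewrite !(mul0r, mulr0).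
case: (boolP [forall j, _]) => [/forallP sm|]; last first.
  move=> /forallPn[ j ]; rewrite -ltnNge => nj.
  have z1 : \prod_j pochhammer (- (m j)%:R) (s j) = 0 :> K.
    by rewrite (bigD1 j)//= pochhammer_neg_small// mul0r.
  rewrite z1 !(mul0r, mulr0).
  by case: ifP => _; rewrite !(mul0r, mulr0).
have totE : (\sum_i r i = \sum_j s j)%N by exact: exchange_big.
set tot := (\sum_i r i)%N in totE *.
have totm : (tot <= mi_sum m)%N by rewrite totE; apply: leq_sum.
have mono : (\prod_i b i 0 ^+ (n i - r i)) * (\prod_j c j 0 ^+ (m j - s j)) *
    (\prod_i \prod_j (b i 0 * c j 0 - a * D j i) ^+ X i j) =
    (X \in index_mx k l m n)%:R * ((\prod_(i < d | (i < k)%N) b i 0 ^+ n i)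
  * (\prod_(j < d | (j < l)%N) c j 0 ^+ m j)) *
    \prod_i \prod_j scaled_entry i j ^+ X i j.
  pose b' (i : 'I_d) := if (i < k)%N then b i 0 else 1.
  pose c' (j : 'I_d) := if (j < l)%N then c j 0 else 1.
  have -> : \prod_i \prod_j (b i 0 * c j 0 - a * D j i) ^+ X i j =
      (\prod_i b' i ^+ r i) * (\prod_j c' j ^+ s j) *
      \prod_i \prod_j scaled_entry i j ^+ X i j.
    have -> : \prod_j c' j ^+ s j = \prod_i \prod_j c' j ^+ X i j.
      by rewrite [RHS]exchange_big; apply: eq_bigr => j _; rewrite expr_sum.
    rewrite -!big_split /=; apply: eq_bigr => i _.
    rewrite expr_sum -!big_split /=; apply: eq_bigr => j _.
    by rewrite scaled_entryE !exprMn.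
  have -> : (X \in index_mx k l m n) =
      [forall i : 'I_d, (k <= i)%N ==> (r i == n i)] &&
      [forall j : 'I_d, (l <= j)%N ==> (s j == m j)].
    apply/idP/andP => [/set_mem[h1 h2]|[/forall_inP h1 /forall_inP h2]].
      by split; apply/forall_inP => i hi; rewrite ?h1 ?h2.
    by apply/mem_set; split=> i hi; apply/eqP; rewrite ?h1 ?h2.
  have := prod_expr_support rn hb0; have := prod_expr_support sm hc0.
  rewrite -mulnb natrM; rewrite -/(b' _) => e1 e2.
  rewrite mulrA; congr (_ * _).
  rewrite mulrACA e1 e2; ring.
have pm : \prod_j pochhammer (- (m j)%:R) (s j) =
    (-1) ^+ tot * (mi_fact m)%:R * \prod_j ((m j - s j)`!)%:R^-1 :> K.
  rewrite totE -prodrXr /mi_fact natr_prod -!big_split /=.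
  by apply: eq_bigr => j _; rewrite pochhammer_neg_le.
have Pm : pochhammer sigma%:R (mi_sum m) = pochhammer sigma%:R tot *
    pochhammer (sigma + tot)%:R (mi_sum m - tot) :> K.
  by rewrite natrD -pochhammerD subnKC.
have poch0 q j : (0 < q)%N -> pochhammer q%:R j != 0 :> K.
  by move=> q0; apply/prodf_neq0 => i _; rewrite -natrD pnatr_eq0 addn_eq0 negb_and -lt0n q0.
have P0 := poch0 _ tot hsigma.
have Q0 := poch0 _ (mi_sum m - tot)%N (ltn_addr tot hsigma).
have aE : a ^- (sigma + mi_sum m + mi_sum n) =
    a ^- mi_sum n * a ^- (sigma + tot + (mi_sum m - tot)).
  by rewrite -[in RHS]addnA subnKC// exprD invfM mulrC.
have sgE : (-1) ^+ mi_sum m = (-1) ^+ (mi_sum m - tot) * (-1) ^+ tot :> K.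
  by rewrite -exprD subnK.
have sg2 : (-1) ^+ tot * (-1) ^+ tot = 1 :> K by rewrite -expr2 sqrr_sign.
have EX : \prod_i \prod_j ((b i 0 * c j 0 - a * D j i) ^+ X i j / (X i j)`!%:R) =
    (\prod_i \prod_j (b i 0 * c j 0 - a * D j i) ^+ X i j) *
    \prod_i \prod_j (X i j)`!%:R^-1.
  by rewrite -big_split; apply: eq_bigr => i _; rewrite -big_split.
have CM : \prod_j (c j 0 ^+ (m j - s j) / (m j - s j)`!%:R) =
    (\prod_j c j 0 ^+ (m j - s j)) * \prod_j (m j - s j)`!%:R^-1.
  by rewrite -big_split.
rewrite mul1r pm Pm aE sgE EX CM big_split /= -/tot.
set Xin := X \in _ in mono *.
move: mono sg2 Q0 P0.
set pn := \prod_i pochhammer _ _; set bp := \prod_i b i 0 ^+ _.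
set cp := \prod_j c j 0 ^+ (_ - _); set ep := \prod_i \prod_j (_ - _) ^+ _.
set ff := \prod_i \prod_j _^-1; set mf := \prod_j _^-1.
set bn := \prod_(i < d | _) _; set cm := \prod_(j < d | (j < l)%N) _.
set U := \prod_i \prod_j _.
set Q := pochhammer _ (_ - _); set P := pochhammer _ tot.
set s1 := (-1) ^+ (_ - _); set s2 := (-1) ^+ tot.
move: (a ^- mi_sum n) (a ^- (_ + _)) => x y mono sg2 Q0 P0.
(* Brings together the powers of [b], [c] and [E], which [mono] rewrites. *)
transitivity (x * y * s1 * pn * ff * mf * (mi_fact m)%:R / P * (bp * cp * ep)).
  by field; rewrite P0 Q0.
rewrite mono; case: Xin {mono}; last by rewrite !(mul0r, mulr0).
rewrite mul1r; transitivity (x * y * s1 * pn * ff * mf * (mi_fact m)%:R / P * (bn * cm * U) * (s2 * s2)).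
  by rewrite sg2 mulr1.
by ring.
Qed.
End summand.

(** * Expansion of the matrix coefficient *)

Section expansion.
Context {R : realType} (d sigma N : nat).
Local Notation C := R[i].
Variables (a : C) (b c : 'cV[C]_d) (D : 'M[C]_d) (n : {ffun 'I_d -> nat}).
Hypothesis nN : forall i, (n i <= N)%N.
Hypothesis a0 : a != 0.
Local Notation idx := {ffun 'I_d -> {ffun 'I_d -> 'I_N.+1}}.

Definition mx_weight (X : 'M[nat]_d) : C :=
  a ^- mi_sum n *
  (\prod_i (pochhammer (- (n i)%:R) (\sum_j X i j)%N *
     b i 0 ^+ (n i - \sum_j X i j))) *
  (\prod_i \prod_j ((b i 0 * c j 0 - a * D j i) ^+ X i j / (X i j)`!%:R)).

Definition col_sums (X : 'M[nat]_d) : {ffun 'I_d -> nat} :=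
  [ffun j => (\sum_i X i j)%N].

Lemma mi_sum_col_sums X : mi_sum (col_sums X) = (\sum_i \sum_j X i j)%N.
Proof.
by rewrite /mi_sum exchange_big; apply: eq_bigr => j _; rewrite ffunE.
Qed.

(** The factor for the coordinate [i] is [a^-1 * (b_i - \sum_j x i j)]; distributing
    the product of the multinomial expansions over [i] makes one matrix out of
    their exponents. *)
Lemma moebius_expand z : a + cdot c z != 0 ->
  (a + cdot c z) ^- sigma *
    mi_pow ((a + cdot c z)^-1 *: (b + D^T *m z)) n =
  \sum_(A : idx) mx_weight (ffun_mx A) *
    ((a + cdot c z) ^- (sigma + \sum_i \sum_j ffun_mx A i j) *
     mi_pow z (col_sums (ffun_mx A))).
Proof.
set q := a + cdot c z => q0.
pose x i j : C := q^-1 * (b i 0 * c j 0 - a * D j i) * z j 0.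
have fac i : ((q^-1 *: (b + D^T *m z)) i 0) ^+ n i = a ^- n i *
   \sum_(f : {ffun 'I_d -> 'I_N.+1})
     pochhammer (- (n i)%:R) (\sum_j f j)%N * b i 0 ^+ (n i - \sum_j f j) *
     \prod_j (x i j ^+ f j / (f j)`!%:R).
  rewrite -(subr_expr_multinomial (b i 0) (x i) (nN i)) -exprVn -exprMn.
  congr (_ ^+ _); rewrite !mxE.
  under eq_bigr do rewrite mxE.
  have -> : \sum_j x i j = q^-1 * (b i 0 * (q - a) - a * \sum_j D j i * z j 0).
    rewrite /q addrAC subrr add0r /cdot !mulr_sumr -sumrB mulr_sumr.
    by apply: eq_bigr => j _; rewrite /x; ring.
  by field; rewrite q0 a0.
rewrite /mi_pow (eq_bigr _ (fun i _ => fac i)) big_split /= bigA_distr_bigA.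
rewrite mulrA mulr_sumr; apply: eq_bigr => A _.
have -> : \prod_i a ^- n i = a ^- mi_sum n.
  by rewrite /mi_sum -exprVn -prodrXr; apply: eq_bigr => i _; rewrite exprVn.
have mxA i j : ffun_mx A i j = A i j :> nat by rewrite mxE.
have rE i : (\sum_j ffun_mx A i j = \sum_j A i j)%N by apply: eq_bigr.
have zE : \prod_i z i 0 ^+ col_sums (ffun_mx A) i =
    \prod_i \prod_j z j 0 ^+ A i j.
  rewrite [RHS]exchange_big; apply: eq_bigr => j _; rewrite ffunE expr_sum.
  by apply: eq_bigr => i _; rewrite mxA.
have qE : q ^- (\sum_i \sum_j ffun_mx A i j) = \prod_i \prod_j (q^-1) ^+ A i j.
  rewrite -exprVn expr_sum; apply: eq_bigr => i _; rewrite expr_sum.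
  by apply: eq_bigr => j _; rewrite mxA.
rewrite /mx_weight exprD invfM zE qE.
have -> : \prod_i (pochhammer (- (n i)%:R) (\sum_j ffun_mx A i j)%N *
      b i 0 ^+ (n i - \sum_j ffun_mx A i j)) =
    \prod_i (pochhammer (- (n i)%:R) (\sum_j A i j)%N *
      b i 0 ^+ (n i - \sum_j A i j)) :> C.
  by apply: eq_bigr => i _; rewrite rE.
have -> : \prod_i \prod_j ((b i 0 * c j 0 - a * D j i) ^+ ffun_mx A i j /
    (ffun_mx A i j)`!%:R) =
  \prod_i \prod_j ((b i 0 * c j 0 - a * D j i) ^+ A i j / (A i j)`!%:R).
  by apply: eq_bigr => i _; apply: eq_bigr => j _; rewrite mxA.
rewrite big_split /=.
have -> : \prod_i \prod_j (x i j ^+ A i j / (A i j)`!%:R) =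
    (\prod_i \prod_j ((b i 0 * c j 0 - a * D j i) ^+ A i j / (A i j)`!%:R)) *
    ((\prod_i \prod_j (q^-1) ^+ A i j) * \prod_i \prod_j z j 0 ^+ A i j).
  rewrite -!big_split; apply: eq_bigr => i _; rewrite -!big_split.
  by apply: eq_bigr => j _ /=; rewrite /x !exprMn; ring.
ring.
Qed.

End expansion.

Theorem lemma5p1 (R : realType) (d sigma k l : nat)
    (hd : (1 <= d)%N) (hsigma : (d.+1 <= sigma)%N)
    (hk : (1 <= k <= d)%N) (hl : (1 <= l <= d)%N)
    (a : R[i]) (b c : 'cV[R[i]]_d) (D : 'M[R[i]]_d)
    (hg : SU1 (block_mx a%:M b^T c D))
    (hb : forall i : 'I_d, (i < k)%N -> b i 0 != 0)
    (hb0 : forall i : 'I_d, (k <= i)%N -> b i 0 = 0)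
    (hc : forall j : 'I_d, (j < l)%N -> c j 0 != 0)
    (hc0 : forall j : 'I_d, (l <= j)%N -> c j 0 = 0)
    (m n : {ffun 'I_d -> nat}) :
  su_pi_coef sigma m n (block_mx a%:M b^T c D) =
  (Num.sqrt (pochhammer sigma%:R (mi_sum m) * pochhammer sigma%:R (mi_sum n) /
             ((mi_fact m)%:R * (mi_fact n)%:R)))%:C
  * (-1) ^+ mi_sum m * a ^- (sigma + mi_sum m + mi_sum n)
  * (\prod_(i < d | (i < k)%N) b i 0 ^+ n i)
  * (\prod_(j < d | (j < l)%N) c j 0 ^+ m j)
  * \sum_(A \in index_mx k l m n)
      ((\prod_(j < d) pochhammer (- (m j)%:R) (\sum_(i < d) A i j)%N)
       * (\prod_(i < d) pochhammer (- (n i)%:R) (\sum_(j < d) A i j)%N)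
       / pochhammer sigma%:R (\sum_(i < d) \sum_(j < d) A i j)%N
       * (\prod_(i < d) \prod_(j < d) ((A i j)`!)%:R^-1)
       * (\prod_(j < d | (j < l)%N)
            ((\prod_(i < d | (i < k)%N)
                (1 - a * D j i / (b i 0 * c j 0)) ^+ A i j)
             * (\prod_(i < d | (k <= i)%N)
                (- (a * D j i / c j 0)) ^+ A i j)))
       * (\prod_(j < d | (l <= j)%N)
            ((\prod_(i < d | (i < k)%N)
                (- (a * D j i / b i 0)) ^+ A i j)
             * (\prod_(i < d | (k <= i)%N)
                (- (a * D j i)) ^+ A i j)))).
Proof.
have ca : \sum_j Normc.normc (c j 0) ^+ 2 < Normc.normc a ^+ 2.
  by rewrite (SU1_normc hg) ltrDr ltr01.
have a0 := kernel_center_neq0 ca.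
pose N := mi_sum n.
have nN i : (n i <= N)%N by rewrite /N /mi_sum (bigD1 i)//= leq_addr.
pose alpha := (sigma - d.+1)%N.
have sE : (alpha + d).+1 = sigma by rewrite -addnS subnK.
have s0 : (0 < sigma)%N by rewrite -sE.
pose nrm (p : {ffun 'I_d -> nat}) : R :=
  Num.sqrt (pochhammer sigma%:R (mi_sum p) / (mi_fact p)%:R).
rewrite (fsum_bounded_mx (N := N)); last first.
  move=> X _ + i j; apply: contra_neqT; rewrite -ltnNge => Xbig.
  rewrite [X in _ * X / _](bigD1 i)//= pochhammer_neg_small ?(mul0r, mulr0)//.
  by rewrite (leq_ltn_trans (nN i))// (leq_trans Xbig)// (bigD1 j)//= leq_addr.
have suE : su_pi_coef sigma m n (block_mx a%:M b^T c D) =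
    \sum_(A : {ffun 'I_d -> {ffun 'I_d -> 'I_N.+1}})
      (nrm m * nrm n)%:C * mx_weight a b c D n (ffun_mx A) *
      dot_mono alpha m (fun z =>
        (a + cdot c z) ^- (sigma + \sum_i \sum_j ffun_mx A i j) *
        mi_pow z (col_sums (ffun_mx A))).
  have nI (A : {ffun 'I_d -> {ffun 'I_d -> 'I_N.+1}}) : ball_bmeas (fun z =>
        (a + cdot c z) ^- (sigma + \sum_i \sum_j ffun_mx A i j) *
        mi_pow z (col_sums (ffun_mx A))).
    by apply: ball_bmeasM; [exact: (ball_bmeas_kernel ca)|exact: ball_bmeas_mi_pow].
  under eq_bigr do rewrite -dot_monoZ//.
  rewrite -dot_mono_sum; last first.
    by move=> A; apply: ball_bmeasM => //; exact: ball_bmeas_cst.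
  rewrite /su_pi_coef /dot_mono /bergman_dot; apply: eq_ball_integral => t tB.
  set z := cvec t.
  have q0 : a + cdot c z != 0.
    have [r [r0 r1 /(_ t tB) zr]] := kernel_contraction ca.
    have -> : a + cdot c z = a * (1 - - (cdot c z / a)) by field.
    rewrite mulf_neq0// subr_eq0; apply/eqP => e1.
    by move: zr; rewrite -e1 Normc.normc1 leNgt r1.
  congr (_ * _).
  rewrite /su_pi block_mxKul block_mxKur block_mxKdl block_mxKdr trmxK.
  rewrite (_ : a%:M 0 0 = a); last by rewrite mxE.
  rewrite (_ : (c^T *m z) 0 0 = cdot c z); last first.
    by rewrite mxE; apply: eq_bigr => j _; rewrite mxE.
  under eq_bigr do rewrite -mulrA.
  rewrite -mulr_sumr -(moebius_expand sigma b D nN a0 q0) /bergman_basis.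
  have conjM (x y : R[i]) : conjc (x * y) = conjc x * conjc y by exact: rmorphM.
  by rewrite -/(nrm _) -/(nrm _) conjM conjc_real rmorphM /=; ring.
rewrite suE mulr_sumr; apply: eq_bigr => A _.
rewrite (dot_mono_kernel _ _ _ ca) /=.
have nrmE : Num.sqrt (pochhammer sigma%:R (mi_sum m) * pochhammer sigma%:R (mi_sum n) /
             ((mi_fact m)%:R * (mi_fact n)%:R)) = nrm m * nrm n.
  rewrite /nrm -sqrtrM; last first.
    by rewrite divr_ge0// prodr_ge0// => i _; rewrite addr_ge0.
  by congr Num.sqrt; rewrite invfM mulrACA.
have key := summandE a D s0 hb hb0 hc hc0 m n (ffun_mx A).
rewrite nrmE.
set X := ffun_mx A in key *.
transitivity ((nrm m * nrm n)%:C * ((-1) ^+ mi_sum m * a ^- (sigma + mi_sum m + mi_sum n)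
  * (\prod_(i < d | (i < k)%N) b i 0 ^+ n i)
  * (\prod_(j < d | (j < l)%N) c j 0 ^+ m j) *
  (if X \in index_mx k l m n then
   (\prod_(j < d) pochhammer (- (m j)%:R) (\sum_(i < d) X i j)%N)
       * (\prod_(i < d) pochhammer (- (n i)%:R) (\sum_(j < d) X i j)%N)
       / pochhammer sigma%:R (\sum_(i < d) \sum_(j < d) X i j)%N
       * (\prod_(i < d) \prod_(j < d) ((X i j)`!)%:R^-1)
       * (\prod_i \prod_j scaled_entry k l a b c D i j ^+ X i j) else 0)));
  last first.
  by rewrite -scaled_entry_prod; case: ifP => _; ring.
rewrite -key mi_sum_col_sums -/X.
have -> : mi_le (col_sums X) m = [forall j : 'I_d, (\sum_i X i j <= m j)%N].
  by apply: eq_forallb => j; rewrite ffunE.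
have -> : \prod_j (c j 0 ^+ (m j - col_sums X j) / (m j - col_sums X j)`!%:R) =
    \prod_j (c j 0 ^+ (m j - \sum_i X i j) / (m j - \sum_i X i j)`!%:R) :> R[i].
  by apply: eq_bigr => j _; rewrite ffunE.
have -> : (@sqnorm_mono R d alpha m)%:C =
    (mi_fact m)%:R / pochhammer sigma%:R (mi_sum m).
  rewrite /sqnorm_mono sE rmorphM fmorphV rmorph_nat; congr (_ / _).
  by rewrite /pochhammer rmorph_prod; apply: eq_bigr => i _; rewrite rmorphD !rmorph_nat.
rewrite -!mulrA; congr (_ * _); rewrite /mx_weight -!mulrA.
Qed.
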